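(* Let $I$ and $J$ be disjoint index sets, let $C=(c_{k,m})_{k,m\in I\cup J}$ be a positive definite matrix with real entries, and let $((a_i)_{i\in I},(a_j)_{j\in J})$ be a two-faced family of self-adjoint random variables in a $*$-probability space $(\mathcal{A},\varphi)$ with $\varphi$ tracial, having a (centered) bi-free central limit distribution with covariance matrix $C$. For each $N\in\mathbb{N}$ let $((X_N^i)_{i\in I},(X_N^j)_{j\in J})$ be a self-adjoint $C$-random two-faced family of $N\times N$ matrices on $L^{\infty-}(\Omega,\mu)$. Then for every $n\in\mathbb{N}$ and every function $\chi:\{1,\dots,n\}\to I\cup J$, $$\lim_{N\to\infty}\frac1N \mathrm{Tr}\big(E_{\mathcal{L}(\mathcal{X}_N)}(X_N^{\chi(1)}X_N^{\chi(2)}\cdots X_N^{\chi(n)})\big)=\varphi(a_{\chi(1)}a_{\chi(2)}\cdots a_{\chi(n)}).$$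
   Context: **Positive definite.** A matrix $C$ indexed by $(I\cup J)\times(I\cup J)$ is called positive definite if it is Hermitian and $(c_{\chi(k),\chi(l)})_{k,l=1}^m\ge 0$ (positive semidefinite, possibly singular) for all $m\in\mathbb{N}$ and $\chi:\{1,\dots,m\}\to I\cup J$. **Bi-free cumulants.** A non-commutative probability space $(\mathcal{A},\varphi)$ is a unital complex algebra with a unital linear functional. For $\chi:\{1,\dots,n\}\to\{l,r\}$ with $\chi^{-1}(l)=\{i_1<\dots<i_p\}$ and $\chi^{-1}(r)=\{i_{p+1}>\dots>i_n\}$, let $s_\chi$ be the permutation $s_\chi(k)=i_k$. Let $NC(n)$ be the lattice of non-crossing partitions of $\{1,\dots,n\}$ with Möbius function $\mu_n$ and largest element $1_n$; for a partition $\pi$, $s_\chi\circ\pi$ is the partition with blocks $s_\chi(V)$, $V\in\pi$, and $BNC(n,\chi)=\{s_\chi\circ\pi:\pi\in NC(n)\}$. For a partition $\pi$ put $\varphi_\pi(a_1,\dots,a_n)=\prod_{V\in\pi}\varphi(a_{v_1}\cdots a_{v_k})$, where $V=\{v_1<\dots<v_k\}$. The bi-free cumulants are $$\kappa_\chi(a_1,\dots,a_n)=\sum_{\pi\in BNC(n,\chi)}\varphi_\pi(a_1,\dots,a_n)\,\mu_n(s_\chi^{-1}\circ\pi,1_n).$$ **Bi-free central limit distribution.** A two-faced family $((s_i)_{i\in I},(s_j)_{j\in J})$ in $(\mathcal{A},\varphi)$ (elements indexed by $I$ are left, those indexed by $J$ are right) has a (centered) bi-free central limit distribution with covariance matrix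 $C$ if for every $n$ and every $\alpha:\{1,\dots,n\}\to I\cup J$, with $\chi(m)=l$ when $\alpha(m)\in I$ and $\chi(m)=r$ when $\alpha(m)\in J$, one has $\kappa_\chi(s_{\alpha(1)},\dots,s_{\alpha(n)})=0$ if $n=1$ or $n\ge3$, and $c_{k,m}=\varphi(s_ks_m)$ for all $k,m\in I\cup J$. **Bi-matrix model.** $(\Omega,\mu)$ is a probability space, $L^{\infty-}(\Omega,\mu)=\bigcap_{p\ge1}L^p(\Omega,\mu)$, and $E(f)=\int_\Omega f\,d\mu$. Let $\mathcal{X}=L^{\infty-}(\Omega,\mu)$; elements of $L^{\infty-}(\Omega,\mu)$ act on $\mathcal{X}$ by multiplication. Let $\mathcal{X}_N=M_N(\mathcal{X})$ and let $\mathcal{L}(\mathcal{X}_N)$ be the algebra of linear operators on $\mathcal{X}_N$. For a matrix $[T_{i,j}]$ with entries in $L^{\infty-}(\Omega,\mu)$ define $L([T_{i,j}]),R([T_{i,j}])\in\mathcal{L}(\mathcal{X}_N)$ by $$L([T_{i,j}])[\eta_{i,j}]=\Big[\sum_{k=1}^N T_{i,k}\eta_{k,j}\Big],\qquad R([T_{i,j}])[\eta_{i,j}]=\Big[\sum_{k=1}^N T_{k,j}\eta_{i,k}\Big].$$ For $A\in\mathcal{L}(\mathcal{X}_N)$, $E_{\mathcal{L}(\mathcal{X}_N)}(A)\in M_N(\mathbb{C})$ is obtained by applying $E$ to each entry of $A(1_N)$, where $1_N=\mathrm{diag}(1,\dots,1)\in\mathcal{X}_N$. $\mathrm{Tr}$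 is the unnormalized trace on $M_N(\mathbb{C})$. **Self-adjoint $C$-random two-faced family of $N\times N$ matrices.** This is a family $((X^i_N)_{i\in I},(X^j_N)_{j\in J})$ (for each $N$) with $X^k_N=L([X^k_{i,j;N}]_{N\times N})$ for $k\in I$ and $X^k_N=R([X^k_{i,j;N}]_{N\times N})$ for $k\in J$, with entries $X^k_{i,j;N}\in L^{\infty-}(\Omega,\mu)$ such that: 1. $E(X^k_{i,j;N})=0$ for all $1\le i,j\le N$, $k\in I\cup J$; 2. $X^k_{j,i;N}=\overline{X^k_{i,j;N}}$ for all $1\le i,j\le N$, $k\in I\cup J$; 3. $\{\{X^k_{i,j;N}:k\in I\cup J\}:1\le i\le j\le N\}$ is an independent family of sets of random variables; 4. $E(X^{k_1}_{i,j;N}X^{k_2}_{j,i;N})=\frac1N c_{k_1,k_2}$ for all $1\le i,j\le N$, $k_1,k_2\in I\cup J$; 5. for every $m\in\mathbb{N}$ and $\chi:\{1,\dots,m\}\to I\cup J$ there are a constant $M(\chi,m)>0$ and $N_0\in\mathbb{N}$ such that for all $N>N_0$, $$\sup_{1\le i\le j\le N}|E(X^{\chi(1)}_{\lambda(1),\tau(1);N}\cdots X^{\chi(m)}_{\lambda(m),\tau(m);N})|\le M(\chi,m)N^{-m/2},$$ for every choice of $(\lambda(l),\tau(l))\in\{(i,j),(j,i)\}$, $l=1,\dots,m$. *)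

(* Defs.v *)
From HB Require Import structures.
From mathcomp Require Import all_boot all_order all_algebra.
From mathcomp Require Import fingroup perm.
From mathcomp Require Import generic_quotient ring_quotient.
From mathcomp Require Import complex.
From mathcomp Require Import all_classical all_reals all_analysis.
From mathcomp Require Import measurable_realfun.
Import numFieldNormedType.Exports.

Set Implicit Arguments.
Unset Strict Implicit.
Unset Printing Implicit Defensive.

Import Order.TTheory GRing.Theory Num.Theory.

Local Open Scope ring_scope.

Section Mobius.
Variables (T : finType) (L : {set T}) (le : rel T).

Fixpoint mobius_rec (k : nat) (x y : T) : int :=
  if k is k'.+1 then
    if x == y then 1
    else if le x y then
      - \sum_(z in L | [&& le x z, le z y & z != y]) mobius_rec k' x z
    else 0
  else 0.

(* Recursion depth #|L| suffices: a strict chain in L has at most #|L| terms;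
   see mobius_sum. *)
Definition mobius (x y : T) : int := mobius_rec #|L| x y.

Hypothesis le_refl : {in L, reflexive le}.
Hypothesis le_anti : {in L &, antisymmetric le}.
Hypothesis le_trans : {in L & &, transitive le}.

Let below (x y : T) := [set z in L | [&& le x z, le z y & z != y]].

Let mobius_rec_stable k1 k2 x y : x \in L -> y \in L ->
  (#|below x y| < k1)%N -> (#|below x y| < k2)%N ->
  mobius_rec k1 x y = mobius_rec k2 x y.
Proof.
elim: k1 k2 y => // k1 IH [//|k2] y xL yL h1 h2 /=.
case: eqP => // _; case: ifP => // lexy; congr (- _).
apply: eq_bigr => z /andP[zL /and3P[xz zy zy']].
have lt : (#|below x z| < #|below x y|)%N.
  apply: fintype.proper_card; apply/fintype.properP; split.
    apply/fintype.subsetP => w; rewrite !inE => /andP[wL /and3P[xw wz wz']].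
    rewrite wL xw (le_trans zL wL yL wz zy) /=.
    apply: contraNneq wz' => wy; subst w.
    by apply/eqP/le_anti => //; rewrite wz zy.
  by exists z; rewrite !inE ?zL ?xz ?zy ?zy' ?eqxx ?andbF.
by apply: IH => //; [exact: leq_trans lt _ | exact: leq_trans lt _].
Qed.

Lemma mobius_sum x y : x \in L -> y \in L -> le x y ->
  \sum_(z in L | le x z && le z y) mobius x z = (x == y)%:R.
Proof.
move=> xL yL xy.
have lt z : z \in L -> (#|below x z| < #|L|)%N.
  move=> zL; apply: fintype.proper_card; apply/fintype.properP; split.
    by apply/fintype.subsetP => w; rewrite inE => /andP[].
  by exists z => //; rewrite inE eqxx !andbF.
rewrite (bigD1 y) /=; last by rewrite yL xy le_refl.
rewrite /mobius -(@mobius_rec_stable #|L|.+1 #|L| x y) ?lt //; last first.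
  by rewrite ltnS ltnW ?lt.
rewrite /= xy; have [-> | xy'] := eqVneq x y.
  rewrite big1 ?addr0 // => z /andP[/and3P[zL yz zy] zy'].
  case/eqP: zy'; apply: le_anti => //; by rewrite yz zy.
rewrite addrC; apply/eqP; rewrite subr_eq0; apply/eqP.
by apply: eq_bigl => z; rewrite -!andbA.
Qed.
End Mobius.

Section NonCrossing.
Variable n : nat.
Local Notation part := {set {set 'I_n}}.

Definition noncrossing (pi : part) : bool :=
  [forall V in pi, forall W in pi, forall a in V, forall b in W,
   forall c in V, forall e in W, (a < b < c)%N && (c < e)%N ==> (V == W)].

Definition NC : {set part} :=
  [set pi | finset.partition pi [set: 'I_n] & noncrossing pi].

Definition refines (pi rho : part) : bool :=
  [forall V in pi, exists W in rho, V \subset W].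

Lemma refines_refl : {in NC, reflexive refines}.
Proof.
by move=> pi _; apply/forall_inP => V Vpi; apply/exists_inP; exists V.
Qed.

Lemma refines_trans : {in NC & &, transitive refines}.
Proof.
move=> rho pi tau _ _ _ /forall_inP pr /forall_inP rt.
apply/forall_inP => V /pr/exists_inP[W /rt/exists_inP[U Ut WU] VW].
by apply/exists_inP; exists U => //; exact: fintype.subset_trans WU.
Qed.

Lemma refines_anti : {in NC &, antisymmetric refines}.
Proof.
have sub (pi rho : part) : finset.partition pi [set: 'I_n] ->
    refines pi rho -> refines rho pi -> pi \subset rho.
  move=> /and3P[_ triv n0] /forall_inP pr /forall_inP rp.
  apply/fintype.subsetP => V Vpi.
  have /exists_inP[W Wr VW] := pr V Vpi.
  have /exists_inP[V' V'pi WV'] := rp W Wr.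
  have [x xV] : exists x, x \in V.
    by apply/set0Pn; apply: contraNneq n0 => <-.
  have VV' : V = V'.
    apply: etrans (esym (def_pblock triv Vpi xV)) (def_pblock triv V'pi _).
    exact: fintype.subsetP WV' _ (fintype.subsetP VW _ xV).
  suff -> : V = W by [].
  rewrite -VV' in WV'.
  by apply/eqP; rewrite finset.eqEsubset VW.
move=> pi rho; rewrite !finset.inE => /andP[pp _] /andP[pr _] /andP[h1 h2].
by apply/eqP; rewrite finset.eqEsubset !sub.
Qed.

Definition NC_mobius : part -> part -> int := mobius NC refines.

Lemma NC_mobius_sum (pi rho : part) : pi \in NC -> rho \in NC ->
  refines pi rho ->
  \sum_(sigma in NC | refines pi sigma && refines sigma rho)
     NC_mobius pi sigma = (pi == rho)%:R.
Proof. exact: (mobius_sum refines_refl refines_anti refines_trans). Qed.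

Definition NC_top : part := [set [set: 'I_n]].

(* [chi m = true] means that the m-th variable is left. *)
Variable chi : 'I_n -> bool.

(* The values s_chi(1), ..., s_chi(n): left positions increasing, then right
   positions decreasing. *)
Definition s_seq : seq 'I_n :=
  [seq i <- enum 'I_n | chi i] ++ rev [seq i <- enum 'I_n | ~~ chi i].

Lemma s_seq_perm : perm_eq s_seq (enum 'I_n).
Proof. by rewrite /s_seq perm_sym -(perm_filterC chi) perm_cat2l perm_sym perm_rev. Qed.

Lemma size_s_seq : size s_seq = n.
Proof. by rewrite (perm_size s_seq_perm) size_enum_ord. Qed.

Definition s_fun (k : 'I_n) : 'I_n := nth k s_seq k.

Lemma s_fun_inj : injective s_fun.
Proof.
move=> i j; rewrite /s_fun (set_nth_default i j) ?size_s_seq // => /eqP.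
rewrite nth_uniq ?size_s_seq // => [/eqP/val_inj //|].
by rewrite (perm_uniq s_seq_perm) enum_uniq.
Qed.

Definition s_perm : {perm 'I_n} := perm s_fun_inj.

Definition part_image (s : {perm 'I_n}) (pi : part) : part :=
  [set s @: V | V : {set 'I_n} in pi].

Definition BNC : {set part} := [set part_image s_perm pi | pi in NC].

Variables (C : nzRingType) (A : lalgType C) (phi : A -> C).

(* Products over blocks are taken in increasing order of 'I_n. *)
Definition phi_part (pi : part) (a : 'I_n -> A) : C :=
  \prod_(V in pi) phi (\prod_(i in V) a i).

Definition bifree_cumulant (a : 'I_n -> A) : C :=
  \sum_(pi in BNC)
    phi_part pi a * (NC_mobius (part_image s_perm^-1 pi) NC_top)%:~R.
End NonCrossing.

Local Open Scope classical_set_scope.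
Local Open Scope quotient_scope.

Notation normc := ComplexField.Normc.normc.

Section RandomVariables.
Context (d : measure_display) (T : measurableType d) (R : realType).
Variable P : probability T R.
Local Notation C := R[i].

(* Complex random variables with finite absolute moments of all orders. *)
Definition Linfminus_pred : {pred T -> C} := fun f =>
  `[< [/\ measurable_fun setT (fun x => complex.Re (f x)),
          measurable_fun setT (fun x => complex.Im (f x))
        & forall p : R, 1 <= p ->
            (fun x => normc (f x)) \in Lfun P p%:E] >].

Lemma normc_ge0 (z : C) : 0 <= normc z.
Proof. by case: z => a b; exact: sqrtr_ge0. Qed.

Lemma measurable_normc (f : T -> C) :
  measurable_fun setT (fun x => complex.Re (f x)) ->
  measurable_fun setT (fun x => complex.Im (f x)) ->
  measurable_fun setT (fun x => normc (f x)).
Proof.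
move=> mr mi.
have -> : (fun x => normc (f x)) =
    Num.sqrt \o (fun x => complex.Re (f x) ^+ 2 + complex.Im (f x) ^+ 2).
  by apply/funext => x /=; case: (f x).
apply: measurableT_comp.
  by apply: continuous_measurable_fun; exact: sqrt_continuous.
by apply: measurable_funD; exact: measurable_funX.
Qed.

Lemma LfunP_ge0 (h : T -> R) (p : R) : (forall x, 0 <= h x) ->
  measurable_fun setT h -> 1 <= p ->
  h \in Lfun P p%:E <-> (\int[P]_x (h x `^ p)%:E < +oo)%E.
Proof.
move=> h0 mh p1; have p0 : 0 < p by exact: lt_le_trans p1.
have E : 'N[P]_p%:E[EFin \o h]%E = ((\int[P]_x (h x `^ p)%:E) `^ p^-1)%E.
  rewrite unlock /Lnorm; congr (_ `^ _)%E; apply: eq_integral => x _ /=.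
  by rewrite ger0_norm.
split.
  rewrite inE => /andP[_]; rewrite inE /= /finite_norm E.
  by apply: lty_poweRy; rewrite gt_eqF ?invr_gt0.
move=> hoo; rewrite inE; apply/andP; split; first by rewrite inE.
by rewrite inE /= /finite_norm E; exact: poweR_lty.
Qed.

Lemma Lfun_dom (h g : T -> R) (p : R) : 1 <= p -> (forall x, 0 <= h x <= g x) ->
  measurable_fun setT h -> g \in Lfun P p%:E -> h \in Lfun P p%:E.
Proof.
move=> p1 hg mh Lg; have p0 : 0 < p by exact: lt_le_trans p1.
have h0 x : 0 <= h x by have /andP[] := hg x.
have g0 x : 0 <= g x by have /andP[a b] := hg x; exact: le_trans b.
have mg : measurable_fun setT g by move: Lg; rewrite inE => /andP[]; rewrite inE.
apply/LfunP_ge0 => //; move/LfunP_ge0: Lg => /(_ g0 mg p1).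
apply: le_lt_trans; apply: ge0_le_integral => //=.
- by move=> x _; rewrite lee_fin powR_ge0.
- by apply/measurable_EFinP; apply: (measurableT_comp (measurable_powR _)).
- by apply/measurable_EFinP; apply: (measurableT_comp (measurable_powR _)).
- move=> x _; rewrite lee_fin; apply: ge0_ler_powR; rewrite ?nnegrE//.
  + exact: ltW.
  + by have /andP[] := hg x.
Qed.

Lemma LfunM (h g : T -> R) : (forall x, 0 <= h x) -> (forall x, 0 <= g x) ->
  (forall p : R, 1 <= p -> h \in Lfun P p%:E) ->
  (forall p : R, 1 <= p -> g \in Lfun P p%:E) ->
  forall p : R, 1 <= p -> (fun x => h x * g x) \in Lfun P p%:E.
Proof.
move=> h0 g0 Lh Lg p p1; have p0 : 0 < p by exact: lt_le_trans p1.
have mL (k : T -> R) : (forall p : R, 1 <= p -> k \in Lfun P p%:E) ->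
    measurable_fun setT k.
  by move=> /(_ _ (lexx _)); rewrite inE => /andP[]; rewrite inE.
have mh := mL _ Lh; have mg := mL _ Lg.
have p2 : 1 <= p * 2 by rewrite (le_trans p1)// ler_peMr ?ler1n// ltW.
apply/LfunP_ge0 => //.
- by move=> x; rewrite mulr_ge0.
- exact: measurable_funM.
have /(LfunP_ge0 h0 mh p2) ih := Lh _ p2.
have /(LfunP_ge0 g0 mg p2) ig := Lg _ p2.
have mpow (k : T -> R) (q : R) : measurable_fun setT k ->
    measurable_fun setT (fun x => (k x `^ q)%:E).
  move=> mk; apply/measurable_EFinP.
  exact: (measurableT_comp (measurable_powR _)).
apply: (@le_lt_trans _ _
  (\int[P]_x ((h x `^ (p * 2))%:E + (g x `^ (p * 2))%:E))%E).
  apply: ge0_le_integral => //=.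
  - by move=> x _; rewrite lee_fin powR_ge0.
  - by apply: mpow; exact: measurable_funM.
  - by apply: emeasurable_funD; exact: mpow.
  move=> x _; rewrite -EFinD lee_fin powRM// !powRrM !powR_mulrn ?powR_ge0//.
  have a0 := powR_ge0 (h x) p; have b0 := powR_ge0 (g x) p.
  case: (lerP (h x `^ p) (g x `^ p)) => ab.
    by rewrite (le_trans (ler_wpM2r b0 ab))// -expr2 lerDr sqr_ge0.
  by rewrite (le_trans (ler_wpM2l a0 (ltW ab)))// -expr2 lerDl sqr_ge0.
rewrite ge0_integralD//=; first by rewrite lte_add_pinfty.
- by move=> x _; rewrite lee_fin powR_ge0.
- exact: mpow.
- by move=> x _; rewrite lee_fin powR_ge0.
- exact: mpow.
Qed.

Lemma Linfminus_subring_closed : subring_closed Linfminus_pred.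
Proof.
split.
- apply/asboolP; split; [exact: measurable_cst..|] => p p1.
  rewrite (_ : (fun _ => _) = cst 1) ?Lfun_cst//.
  by apply/funext => x; exact: Normc.normc1.
- move=> f g /asboolP[fr fi fL] /asboolP[gr gi gL].
  have rE : (fun x => complex.Re ((f - g) x)) =
     (fun x => complex.Re (f x)) \- (fun x => complex.Re (g x)).
    by apply/funext => x; exact: raddfB.
  have iE : (fun x => complex.Im ((f - g) x)) =
     (fun x => complex.Im (f x)) \- (fun x => complex.Im (g x)).
    by apply/funext => x; exact: raddfB.
  have mr : measurable_fun setT (fun x => complex.Re ((f - g) x)).
    by rewrite rE; exact: measurable_funB.
  have mi : measurable_fun setT (fun x => complex.Im ((f - g) x)).
    by rewrite iE; exact: measurable_funB.
  apply/asboolP; split => // p p1.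
  apply: (@Lfun_dom _ ((fun x => normc (f x)) + (fun x => normc (g x)))) => //.
  + move=> x; rewrite normc_ge0/=.
    by have := le_normcD (f x : Rcomplex R) (- g x); rewrite (normcN (g x)).
  + exact: measurable_normc.
  + by rewrite (Lfun_addr_closed _ _).2 ?fL ?gL ?lee_fin.
- move=> f g /asboolP[fr fi fL] /asboolP[gr gi gL].
  have rE : (fun x => complex.Re ((f * g) x)) =
     (fun x => complex.Re (f x) * complex.Re (g x)
             - complex.Im (f x) * complex.Im (g x)).
    by apply/funext => x /=; rewrite /GRing.mul/=; case: (f x); case: (g x).
  have iE : (fun x => complex.Im ((f * g) x)) =
     (fun x => complex.Re (f x) * complex.Im (g x)
             + complex.Im (f x) * complex.Re (g x)).
    by apply/funext => x /=; rewrite /GRing.mul/=; case: (f x); case: (g x).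
  have mr : measurable_fun setT (fun x => complex.Re ((f * g) x)).
    by rewrite rE; apply: measurable_funB; exact: measurable_funM.
  have mi : measurable_fun setT (fun x => complex.Im ((f * g) x)).
    by rewrite iE; apply: measurable_funD; exact: measurable_funM.
  apply/asboolP; split => // p p1.
  have -> : (fun x => normc ((f * g) x)) = (fun x => normc (f x) * normc (g x)).
    by apply/funext => x; exact: Normc.normcM.
  by apply: LfunM => // x; exact: normc_ge0.
Qed.
HB.instance Definition _ := GRing.isSubringClosed.Build (T -> C) Linfminus_pred
  Linfminus_subring_closed.

Record linfminus : Type := MkLinfminus { linfminus_fun :> T -> C ; _ : linfminus_fun \in Linfminus_pred }.
HB.instance Definition _ := [isSub for linfminus_fun].
HB.instance Definition _ := [Choice of linfminus by <:].
HB.instance Definition _ := GRing.SubChoice_isSubComPzRing.Build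
  (T -> C) Linfminus_pred linfminus Linfminus_subring_closed.

Lemma linfminus_oner_neq0 : 1 != 0 :> linfminus.
Proof.
apply/eqP => /(congr1 linfminus_fun) E.
have T0 : [set: T] = set0.
  apply/seteqP; split => // x _; have /(congr1 (fun f => f x)) := E.
  by move/eqP; rewrite (oner_eq0 C).
by have := @probability_setT _ _ _ P; rewrite T0 measure0 => /eqP; rewrite eqe eq_sym oner_eq0.
Qed.
HB.instance Definition _ := GRing.PzSemiRing_isNonZero.Build linfminus linfminus_oner_neq0.

Definition ae0 : {pred linfminus} := fun f => `[< {ae P, forall x, f x = 0} >].
Lemma ae0_idealr_closed : idealr_closed ae0.
Proof.
split.
- by apply/asboolP; apply/nearW.
- apply/asboolP => -[A [mA A0 sA]].
  have AT : A = setT.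
    apply/seteqP; split => // x _; apply: sA => /= /eqP.
    by rewrite (oner_eq0 C).
  by move: A0; rewrite AT probability_setT => /eqP; rewrite eqe oner_eq0.
- move=> a f g /asboolP af /asboolP ag; apply/asboolP.
  near=> x.
  rewrite -[LHS]/(a x * f x + g x).
  have -> : f x = 0 by near: x.
  have -> : g x = 0 by near: x.
  by rewrite mulr0 addr0.
Unshelve. all: by end_near.
Qed.
HB.instance Definition _ := isIdealr.Build linfminus ae0 ae0_idealr_closed.

(* L^{oo-}: the functions above modulo almost sure equality. *)
Definition Linfminus : Type := {ideal_quot ae0}.
HB.instance Definition _ := GRing.ComNzRing.on Linfminus.
HB.instance Definition _ := EqQuotient.on Linfminus.
HB.instance Definition _ := NzRingQuotient.on Linfminus.

Lemma cst_Linfminus (c : C) : (fun=> c) \in Linfminus_pred.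
Proof.
apply/asboolP; split; [exact: measurable_cst..|] => p p1.
by rewrite -[fun _ => _]/(cst (normc c)) Lfun_cst.
Qed.
Definition cstL (c : C) : linfminus := MkLinfminus (cst_Linfminus c).

Definition scaleL (c : C) (f : Linfminus) : Linfminus :=
  \pi_Linfminus (cstL c) * f.

Lemma scaleLA a b f : scaleL a (scaleL b f) = scaleL (a * b) f.
Proof.
rewrite /scaleL mulrA -rmorphM; congr (\pi_Linfminus _ * _).
exact: val_inj.
Qed.
Lemma scaleL1 : left_id 1 scaleL.
Proof.
move=> f; rewrite /scaleL (_ : cstL 1 = 1) ?rmorph1 ?mul1r //.
exact: val_inj.
Qed.
Lemma scaleLDr : right_distributive scaleL +%R.
Proof. by move=> c f g; rewrite /scaleL mulrDr. Qed.
Lemma scaleLDl f : {morph scaleL^~ f : a b / a + b}.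
Proof.
move=> a b; rewrite /scaleL -mulrDl -rmorphD; congr (\pi_Linfminus _ * _).
exact: val_inj.
Qed.
HB.instance Definition _ := GRing.Zmodule_isLmodule.Build C Linfminus
  scaleLA scaleL1 scaleLDr scaleLDl.

Lemma conj_Linfminus (f : linfminus) : (fun x => (f x)^*) \in Linfminus_pred.
Proof.
case: f => f /= /asboolP[fr fi fL]; apply/asboolP; split.
- by rewrite (_ : (fun _ => _) = (fun x => complex.Re (f x)))//; apply/funext => x; case: (f x).
- rewrite (_ : (fun _ => _) = \- (fun x => complex.Im (f x))); last first.
    by apply/funext => x /=; case: (f x).
  exact: measurable_funN.
- move=> p p1; rewrite (_ : (fun _ => _) = (fun x => normc (f x))) ?fL//.
  by apply/funext => x; case: (f x) => u v /=; rewrite sqrrN.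
Qed.

Definition conjL (f : Linfminus) : Linfminus :=
  \pi_Linfminus (MkLinfminus (conj_Linfminus (repr f))).

Lemma eqmodL (f g : linfminus) :
  \pi_Linfminus f = \pi_Linfminus g <-> {ae P, forall x, f x = g x}.
Proof.
split.
  move/eqP; rewrite -Quotient.idealrBE => /asboolP; apply: filterS => x /= h.
  by apply/eqP; rewrite -subr_eq0; apply/eqP.
move=> h; apply/eqP; rewrite -Quotient.idealrBE; apply/asboolP.
by move: h; apply: filterS => x /= h; apply/eqP; rewrite subr_eq0; apply/eqP.
Qed.

Lemma conjL_pi (f : linfminus) :
  conjL (\pi_Linfminus f) = \pi_Linfminus (MkLinfminus (conj_Linfminus f)).
Proof.
apply/eqmodL; have : {ae P, forall x, repr (\pi_Linfminus f) x = f x}.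
  by apply/eqmodL; rewrite reprK.
by apply: filterS => x /= ->.
Qed.

Definition expectL (f : Linfminus) : C :=
  ((\int[P]_x complex.Re (repr f x)) +i* (\int[P]_x complex.Im (repr f x)))%C.

Lemma expectL_pi (f : linfminus) : expectL (\pi_Linfminus f) =
  ((\int[P]_x complex.Re (f x)) +i* (\int[P]_x complex.Im (f x)))%C.
Proof.
have [rr ri _] : [/\ measurable_fun setT (fun x => complex.Re (repr (\pi_Linfminus f) x)),
  measurable_fun setT (fun x => complex.Im (repr (\pi_Linfminus f) x)) & True].
  by move: (repr _) => [g /= /asboolP[]].
have [fr fi _] : [/\ measurable_fun setT (fun x => complex.Re (f x)),
  measurable_fun setT (fun x => complex.Im (f x)) & True].
  by move: (f) => [g /= /asboolP[]].
have e : {ae P, forall x, repr (\pi_Linfminus f) x = f x}.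
  by apply/eqmodL; rewrite reprK.
rewrite /expectL /Rintegral; congr ((fine _) +i* (fine _))%C.
- apply: ae_eq_integral => //; try exact/measurable_EFinP.
  by apply: filterS e => x /= ->.
- apply: ae_eq_integral => //; try exact/measurable_EFinP.
  by apply: filterS e => x /= ->.
Qed.

(* The sigma-algebra generated by a set of complex random variables. Changing
   the representatives changes its events by null sets only, so independence
   below does not depend on the choice made by [repr]. *)
Definition sigma_rv (F : set Linfminus) : set (set T) :=
  <<s [set A | exists2 f, F f & exists2 B : set (R * R), measurable B &
        A = (fun x => (complex.Re (repr f x), complex.Im (repr f x))) @^-1` B] >>.

Definition independent_sets (K : eqType) (D : pred K) (F : K -> set Linfminus)
    : Prop :=
  forall (s : seq K) (A : K -> set T), uniq s -> {in s, forall k, D k} ->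
    {in s, forall k, sigma_rv (F k) (A k)} ->
    P (\bigcap_(k in [set` s]) A k) = (\prod_(k <- s) P (A k))%E.

Section Matrices.
Variable N : nat.

(* An alias of the matrix type: here the scalars are the complex numbers, not
   the elements of Linfminus. *)
Definition XN : Type := 'M[Linfminus]_N.
HB.instance Definition _ := GRing.Zmodule.on XN.

Definition scaleXN (c : C) (eta : XN) : XN := \matrix_(i, j) (c *: (eta i j : Linfminus)).

Lemma scaleXNA a b f : scaleXN a (scaleXN b f) = scaleXN (a * b) f.
Proof. by apply/matrixP => i j; rewrite !mxE scalerA. Qed.
Lemma scaleXN1 : left_id 1 scaleXN.
Proof. by move=> f; apply/matrixP => i j; rewrite !mxE scale1r. Qed.
Lemma scaleXNDr : right_distributive scaleXN +%R.
Proof. by move=> c f g; apply/matrixP => i j; rewrite !mxE scalerDr. Qed.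
Lemma scaleXNDl f : {morph scaleXN^~ f : a b / a + b}.
Proof. by move=> a b; apply/matrixP => i j; rewrite !mxE scalerDl. Qed.
HB.instance Definition _ := GRing.Zmodule_isLmodule.Build C XN
  scaleXNA scaleXN1 scaleXNDr scaleXNDl.

Definition LXN : Type := {linear XN -> XN}.

Definition LXN_one : LXN := idfun.
Definition LXN_mul (A B : LXN) : LXN := A \o B.

Definition opL_fun (X : 'M[Linfminus]_N) (eta : XN) : XN :=
  \matrix_(i, j) \sum_k X i k * eta k j.
Definition opR_fun (X : 'M[Linfminus]_N) (eta : XN) : XN :=
  \matrix_(i, j) \sum_k X k j * eta i k.

Lemma scaleLM c (f g : Linfminus) : f * (c *: g) = c *: (f * g).
Proof. by rewrite /GRing.scale /= /scaleL mulrCA. Qed.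

Lemma opL_linear X : linear (opL_fun X).
Proof.
move=> c f g; apply/matrixP => i j; rewrite !mxE scaler_sumr -big_split.
by apply: eq_bigr => k _; rewrite !mxE mulrDr scaleLM.
Qed.
Lemma opR_linear X : linear (opR_fun X).
Proof.
move=> c f g; apply/matrixP => i j; rewrite !mxE scaler_sumr -big_split.
by apply: eq_bigr => k _; rewrite !mxE mulrDr scaleLM.
Qed.
HB.instance Definition _ X := GRing.isLinear.Build C XN XN _ (opL_fun X) (opL_linear X).
HB.instance Definition _ X := GRing.isLinear.Build C XN XN _ (opR_fun X) (opR_linear X).
Definition opL (X : 'M[Linfminus]_N) : LXN := opL_fun X.
Definition opR (X : 'M[Linfminus]_N) : LXN := opR_fun X.

Definition expectLXN (A : LXN) : 'M[C]_N :=
  \matrix_(i, j) expectL (A (1%:M : 'M[Linfminus]_N) i j).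
End Matrices.
End RandomVariables.

Section Statement.
Context (R : realType).
Local Notation C := R[i].

Definition psdmx (m : nat) (M : 'M[C]_m) : Prop :=
  forall v : 'cV[C]_m, 0 <= ((map_mx Num.conj v)^T *m M *m v) 0 0.

Definition positive_definite (K : Type) (c : K -> K -> C) : Prop :=
  (forall k l, c l k = (c k l)^* ) /\
  forall (m : nat) (chi : 'I_m -> K), psdmx (\matrix_(k, l) c (chi k) (chi l)).

Record star_probability_space (A : algType C) (star : A -> A)
    (phi : {scalar A}) : Prop := {
  starK : involutive star;
  starD : {morph star : x y / x + y};
  starZ : forall (z : C) x, star (z *: x) = z^* *: star x;
  starM : forall x y, star (x * y) = star y * star x;
  state1 : phi 1 = 1;
  state_ge0 : forall x, 0 <= phi (star x * x)
}.

Definition tracial (A : algType C) (phi : {scalar A}) : Prop :=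
  forall x y, phi (x * y) = phi (y * x).

Definition is_left (I J : Type) (k : I + J) : bool :=
  if k is inl _ then true else false.

Definition bifree_clt (A : algType C) (phi : {scalar A}) (I J : Type)
    (s : I + J -> A) (c : I + J -> I + J -> C) : Prop :=
  (forall (n : nat) (alpha : 'I_n -> I + J), (n = 1 \/ 3 <= n)%N ->
     bifree_cumulant (fun m => is_left (alpha m)) phi (fun m => s (alpha m)) = 0)
  /\ forall k m, c k m = phi (s k * s m).

Context (d : measure_display) (T : measurableType d) (P : probability T R).

Definition two_faced (I J : Type) (N : nat) (X : I + J -> 'M[Linfminus P]_N)
    (k : I + J) : LXN P N :=
  match k with inl _ => opL (X k) | inr _ => opR (X k) end.

(* [I + J] is the disjoint union of the index sets: [inl] indices are left and
   [inr] indices are right. For N = 0 all conditions are vacuous. *)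
Record C_random (I J : Type) (c : I + J -> I + J -> C)
    (X : forall N, I + J -> 'M[Linfminus P]_N) : Prop := {
  C_random_centered : forall N k i j, expectL (X N k i j) = 0;
  C_random_selfadjoint : forall N k i j, X N k j i = conjL (X N k i j);
  C_random_independent : forall N,
    independent_sets (fun p : 'I_N * 'I_N => (p.1 <= p.2)%N)
      (fun p => [set X N k p.1 p.2 | k in setT]);
  C_random_covariance : forall N k1 k2 i j,
    expectL (X N k1 i j * X N k2 j i) = N%:R^-1 * c k1 k2;
  C_random_moments : forall (m : nat) (chi : 'I_m -> I + J),
    exists2 M : R, 0 < M & exists N0 : nat, forall N, (N0 < N)%N ->
      forall i j : 'I_N, (i <= j)%N ->
      forall lambda tau : 'I_m -> 'I_N,
        (forall l, (lambda l, tau l) \in [:: (i, j); (j, i)]) ->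
        normc (expectL (\prod_(l < m) X N (chi l) (lambda l) (tau l)))
          <= M * N%:R `^ (- (m%:R / 2))
}.
End Statement.

(* Main.v *)
(* Both sides depend only on the word [u] obtained by reading the left letters
   of [chi] in order and then the right letters in reverse order, and both equal
   the sum over the non-crossing pairings of [u] of the products of covariances.

   On the algebraic side, a product over the blocks of a non-crossing partition
   [pi] of such pairing sums is the sum over the pairings refining [pi], so by
   Moebius inversion pairing sums have the required cumulants; since cumulants
   determine moments recursively, the two families of moments agree.

   On the matrix side, left and right multiplications commute and turn the trace
   into that of the matrix product along [u], a sum over closed walks.  A closed
   walk of length [n] with at least [n/2 + 1] vertices has a vertex other than
   its root that is visited once.  By independence its expectation vanishes
   unless the two steps at this vertex traverse the same edge, in which case
   they contribute a covariance and can be erased; the pairing sums of reversed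
   steps obey the same recursion, and their sum over all closed walks is exactly
   the pairing sum of [u].  The remaining walks are too few to matter, as each of
   them has an expectation of order [N ^ (- n / 2)]. *)
Require Import Defs.
From HB Require Import structures.
From mathcomp Require Import all_boot all_order all_algebra.
From mathcomp Require Import fingroup perm.
From mathcomp Require Import complex.
From mathcomp Require Import boolp reals.
From mathcomp Require Import ring lra zify.

Set Implicit Arguments.
Unset Strict Implicit.
Unset Printing Implicit Defensive.

Import Order.TTheory GRing.Theory Num.Theory.

Local Open Scope ring_scope.

(** * Sums over non-crossing pairings *)

Section SplitSums.
Variables (K : comNzRingType) (T : Type).
Implicit Types (s t : seq T) (F G : seq T -> T -> seq T -> K) (w : T -> T -> K).

(** [F a y b] is summed over all decompositions [s = a ++ y :: b]; the recursion moves the letters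
    passed over into the first argument. *)
Fixpoint split_sum s F : K :=
  if s is y :: t then F [::] y t + split_sum t (fun a z b => F (y :: a) z b)
  else 0.

Lemma eq_split_sum s F G :
  (forall a y b, s = a ++ y :: b -> F a y b = G a y b) ->
  split_sum s F = split_sum s G.
Proof.
elim: s F G => //= x s IH F G FG; congr (_ + _); first exact: FG.
by apply: IH => a y b sE; apply: FG; rewrite sE.
Qed.

Lemma split_sum_cat s t F :
  split_sum (s ++ t) F = split_sum s (fun a y b => F a y (b ++ t)) +
    split_sum t (fun a y b => F (s ++ a) y b).
Proof.
elim: s F => [|x s IH] F /=; first by rewrite add0r.
by rewrite IH addrA.
Qed.

Lemma mulr_split_sumr k s F :
  k * split_sum s F = split_sum s (fun a y b => k * F a y b).
Proof. by elim: s F => [|x s IH] F /=; rewrite ?mulr0 // mulrDr IH. Qed.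

Lemma split_sum_exchange (I : Type) (r : seq I) (P : pred I) s
    (F : I -> seq T -> T -> seq T -> K) :
  \sum_(i <- r | P i) split_sum s (F i) =
  split_sum s (fun a y b => \sum_(i <- r | P i) F i a y b).
Proof. by elim: s F => [|x s IH] F /=; rewrite ?big1_eq // big_split IH. Qed.

(** [m] is fuel, because [a] and [b] are not structural subterms of [s]; the value 0 on exhausted
    fuel is never reached when [size s <= m]. *)
Fixpoint nc_pairing_sum_rec m w s : K :=
  match m, s with
  | _, [::] => 1
  | 0, _ => 0
  | m'.+1, x :: s' => split_sum s' (fun a y b =>
      w x y * nc_pairing_sum_rec m' w a * nc_pairing_sum_rec m' w b)
  end.

(* The sum over the non-crossing pairings of the letters of [s] of the product
   of the weights of the pairs, by recursion on the partner of the first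
   letter. *)
Definition nc_pairing_sum w s := nc_pairing_sum_rec (size s) w s.

Lemma nc_pairing_sum_rec_stable m w s :
  (size s <= m)%N -> nc_pairing_sum_rec m w s = nc_pairing_sum w s.
Proof.
move=> sm; rewrite /nc_pairing_sum; have := leqnn (size s).
move: {2 3}(size s) => k; elim: m s sm k => [|m IH] [|x s] sm [|k] //= sk.
apply: eq_split_sum => a y b sE; move: sk sm.
rewrite sE /= size_cat /= !ltnS => sk sm.
by rewrite !(IH _ _ k) //; lia.
Qed.

Lemma nc_pairing_sum_cons w x s :
  nc_pairing_sum w (x :: s) = split_sum s (fun a y b =>
    w x y * nc_pairing_sum w a * nc_pairing_sum w b).
Proof.
rewrite {1}/nc_pairing_sum /=; apply: eq_split_sum => a y b ->.
by rewrite size_cat !nc_pairing_sum_rec_stable //=; lia.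
Qed.

Lemma nc_pairing_sum_nil w : nc_pairing_sum w [::] = 1.
Proof. by []. Qed.

Lemma split_sum_eq0 s F :
  (forall a y b, s = a ++ y :: b -> F a y b = 0) -> split_sum s F = 0.
Proof.
move=> F0; rewrite (@eq_split_sum _ _ (fun _ _ _ => 0)) //.
by elim: s {F F0} => //= x s ->; rewrite addr0.
Qed.

(** The hypothesis leaves [b] as the only possible partner of [a]. By induction on the sizes of [p]
    and [q]: the first letter of [p] is paired within [p] or [q], and in either case the adjacent
    [a] and [b] fall into the same one of the two remaining segments. *)
Lemma nc_pairing_sum_delete w (P : pred T) a b p q :
  (forall z, P z -> [/\ w z a = 0, w z b = 0 & w a z = 0]) ->
  all P p -> all P q ->
  nc_pairing_sum w (p ++ a :: b :: q) = w a b * nc_pairing_sum w (p ++ q).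
Proof.
move=> wP; have [m] := ubnP (size p + size q).
elim: m p q => // m IH [|x p] q.
  move=> _ _ Pq /=; rewrite nc_pairing_sum_cons /= nc_pairing_sum_nil mulr1.
  rewrite split_sum_eq0 ?addr0 // => u y v qE.
  move: Pq; rewrite qE all_cat /= => /and3P[_ /wP[_ _ ->]].
  by rewrite !mul0r.
rewrite /= ltnS => pqm /andP[Px Pp] Pq; have [xa xb _] := wP _ Px.
rewrite !nc_pairing_sum_cons !split_sum_cat /= xa xb !mul0r !add0r mulrDr.
rewrite !mulr_split_sumr; congr (_ + _); apply: eq_split_sum => u y v pE.
  move: Pp pqm; rewrite pE all_cat size_cat /= => /and3P[Pu _ Pv] pqm.
  by rewrite IH //; [ring | lia].
move: Pq pqm; rewrite pE all_cat size_cat /= => /and3P[Pu _ Pv] pqm.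
by rewrite -cat_rcons -cats1 -!catA /= IH //; [ring | lia].
Qed.

(** Every pairing of [s] has [size s / 2] pairs, each contributing [k ^+ 2]; for odd [size s] there
    are none and both sides vanish. *)
Lemma nc_pairing_sum_scale w k s :
  nc_pairing_sum (fun x y => k ^+ 2 * w x y) s =
    k ^+ size s * nc_pairing_sum w s.
Proof.
have [m] := ubnP (size s); elim: m s => // m IH [|x s] sm.
  by rewrite !nc_pairing_sum_nil mul1r.
rewrite !nc_pairing_sum_cons mulr_split_sumr; apply: eq_split_sum => a y b sE.
move: sm; rewrite sE /= size_cat /= => sm; rewrite !IH; [|lia..].
by rewrite addnS !exprS exprD; ring.
Qed.

End SplitSums.

Lemma nc_pairing_sum_map (K : comNzRingType) (T U : Type) (f : T -> U)
    (w : U -> U -> K) s :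
  nc_pairing_sum w (map f s) = nc_pairing_sum (fun x y => w (f x) (f y)) s.
Proof.
have split_sum_map t F : split_sum (map f t) F =
    split_sum t (fun a y b => F (map f a) (f y) (map f b)) :> K.
  by elim: t F => //= y t IH F; rewrite IH.
have [m] := ubnP (size s); elim: m s => // m IH [|x s] //= sm.
rewrite !nc_pairing_sum_cons split_sum_map; apply: eq_split_sum => a y b sE.
move: sm; rewrite sE size_cat /= => sm.
by rewrite !IH //; lia.
Qed.

Lemma ler_norm_split_sum (K : numDomainType) (T : Type) (s : seq T)
    (F G : seq T -> T -> seq T -> K) :
  (forall a y b, s = a ++ y :: b -> `|F a y b| <= G a y b) ->
  `|split_sum s F| <= split_sum s G.
Proof.
elim: s F G => [|y s IH] F G FG /=; first by rewrite normr0.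
apply: le_trans (ler_normD _ _) _; apply: lerD; first exact: FG.
by apply: IH => a z b sE; apply: FG; rewrite sE.
Qed.

Lemma ler_norm_nc_pairing_sum (K : numDomainType) (T : Type)
    (w w' : T -> T -> K) s :
  (forall x y, `|w x y| <= w' x y) ->
  `|nc_pairing_sum w s| <= nc_pairing_sum w' s.
Proof.
move=> ww'; have [m] := ubnP (size s); elim: m s => // m IH [|x s] sm.
  by rewrite !nc_pairing_sum_nil normr1.
rewrite !nc_pairing_sum_cons.
apply: ler_norm_split_sum => a y b sE.
move: sm; rewrite sE /= size_cat /= => sm; rewrite !normrM.
by do 2?[apply: ler_pM => //; rewrite ?mulr_ge0 //]; apply: IH; lia.
Qed.

(** * Non-crossing partitions *)

Section Partitions.
Variables (T : finType).
Implicit Types (rho : {set {set T}}) (V W B : {set T}).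

Lemma partitionP rho V :
  reflect [/\ forall B, B \in rho -> B != set0 /\ B \subset V,
              forall x, x \in V -> exists2 B, B \in rho & x \in B
            & forall B B' x, B \in rho -> B' \in rho -> x \in B -> x \in B' -> B = B']
          (partition rho V).
Proof.
apply: (iffP idP) => [pr|[sub cov triv]].
  have /and3P[/eqP cr tr n0] := pr; split.
  - move=> B Br; split; first by apply: contraNneq n0 => <-.
    by rewrite -cr; exact: bigcup_sup.
  - by move=> x; rewrite -cr => /bigcupP[B Br xB]; exists B.
  - by move=> B B' x Br Br' xB xB'; rewrite -(def_pblock tr Br xB) (def_pblock tr Br' xB').
apply/and3P; split.
- rewrite eqEsubset; apply/andP; split.
    by apply/bigcupsP => B /sub[].
  by apply/subsetP => x /cov[B Br xB]; apply/bigcupP; exists B.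
- apply/trivIsetP => B B' Br Br'; apply: contraNT => /pred0Pn[x /andP[xB xB']].
  by apply/eqP; exact: (triv B B' x).
- by apply/negP => /sub[]; rewrite eqxx.
Qed.

Lemma in_restr rho V B : (B \in rho ::&: V) = (B \in rho) && (B \subset V).
Proof. by rewrite !inE. Qed.

Definition splits rho V1 V2 := [forall B in rho, (B \subset V1) || (B \subset V2)].

Lemma partition_splitU rho V1 V2 : [disjoint V1 & V2] ->
  partition rho (V1 :|: V2) && splits rho V1 V2 =
  [&& partition (rho ::&: V1) V1, partition (rho ::&: V2) V2 &
     (rho ::&: V1) :|: (rho ::&: V2) == rho].
Proof.
move=> dV; apply/idP/idP.
  move=> /andP[/partitionP[sub cov triv] /forall_inP spl].
  have restr (V V' : {set T}) : [disjoint V & V'] -> V \subset V1 :|: V2 ->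
      (forall B, B \in rho -> (B \subset V) || (B \subset V')) -> partition (rho ::&: V) V.
    move=> dVV sV spl'; apply/partitionP; split.
    - by move=> B; rewrite in_restr => /andP[/sub[]].
    - move=> x xV; have [B Br xB] := cov x (subsetP sV _ xV).
      exists B => //; rewrite in_restr Br; have /orP[//|sB] := spl' B Br.
      by have := disjointFr dVV xV; rewrite (subsetP sB _ xB).
    - move=> B B' x; rewrite !in_restr => /andP[Br _] /andP[Br' _]; exact: triv.
  apply/and3P; split.
  - exact: (restr V1 V2 dV (subsetUl _ _) spl).
  - apply: (restr V2 V1); rewrite ?subsetUr 1?disjoint_sym //.
    by move=> B /spl; rewrite orbC.
  - apply/eqP/setP => B; rewrite inE !in_restr -andb_orr.
    by case Br: (B \in rho) => //=; exact: spl.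
move=> /and3P[/partitionP[sub1 cov1 triv1] /partitionP[sub2 cov2 triv2] /eqP rE].
have spl B : B \in rho -> (B \subset V1) || (B \subset V2).
  by rewrite -{1}rE inE !in_restr => /orP[] /andP[_ ->]; rewrite ?orbT.
apply/andP; split; last by apply/forall_inP.
apply/partitionP; split.
- move=> B Br; have := spl B Br; rewrite -{1}rE inE in Br => /orP[] sB.
    case/orP: Br => Br; first by have [-> _] := sub1 _ Br; split => //; rewrite subsetU ?sB.
    by have [-> _] := sub2 _ Br; split => //; rewrite subsetU ?sB.
  case/orP: Br => Br; first by have [-> _] := sub1 _ Br; split => //; rewrite subsetU ?sB ?orbT.
  by have [-> _] := sub2 _ Br; split => //; rewrite subsetU ?sB ?orbT.
- move=> x; rewrite inE => /orP[/cov1|/cov2] [B]; rewrite in_restr => /andP[Br _] xB;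
    by exists B.
- move=> B B' x Br Br' xB xB'.
  have /orP[s1|s1] := spl B Br; have /orP[s2|s2] := spl B' Br'.
  + by apply: (triv1 B B' x); rewrite ?in_restr ?Br ?Br'.
  + by have := disjointFr dV (subsetP s1 _ xB); rewrite (subsetP s2 _ xB').
  + by have := disjointFr dV (subsetP s2 _ xB'); rewrite (subsetP s1 _ xB).
  + by apply: (triv2 B B' x); rewrite ?in_restr ?Br ?Br'.
Qed.

Lemma restrU (r1 r2 : {set {set T}}) V1 V2 : [disjoint V1 & V2] ->
  partition r1 V1 -> partition r2 V2 ->
  (r1 :|: r2) ::&: V1 = r1 /\ (r1 :|: r2) ::&: V2 = r2.
Proof.
move=> dV /partitionP[sub1 _ _] /partitionP[sub2 _ _].
have no B W W' : [disjoint W & W'] -> B != set0 -> B \subset W -> B \subset W' = false.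
  move=> dW /set0Pn[x xB] sW; apply/negP => sW'.
  by have := disjointFr dW (subsetP sW _ xB); rewrite (subsetP sW' _ xB).
split; apply/setP => B; rewrite in_restr inE.
  apply/idP/idP => [/andP[/orP[//|Br] sB]|Br].
    by have [n0 s2] := sub2 _ Br; rewrite (no _ _ _ dV n0 sB) in s2.
  by have [_ ->] := sub1 _ Br; rewrite Br.
apply/idP/idP => [/andP[/orP[Br sB|//]]|Br].
  by have [n0 s1] := sub1 _ Br; rewrite (no _ _ _ dV n0 s1) in sB.
by have [_ ->] := sub2 _ Br; rewrite Br orbT.
Qed.

End Partitions.

Section NonCrossingSums.
Variables (K : comNzRingType) (n : nat).
Local Notation part := {set {set 'I_n}}.
Implicit Types (rho : part) (V W B : {set 'I_n}).

(** Only the pattern [V W V W] is forbidden here, so two blocks are non-crossing when the condition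
    holds in both orders. *)
Definition crossing_free V W := forall a b c e : 'I_n,
  a \in V -> b \in W -> c \in V -> e \in W -> (a < b < c)%N && (c < e)%N -> False.

Lemma noncrossingP rho :
  reflect (forall V W, V \in rho -> W \in rho -> V != W -> crossing_free V W)
          (noncrossing rho).
Proof.
apply: (iffP idP) => [nc V W Vr Wr VW a b c e aV bW cV eW lt|nc].
  move: nc => /forall_inP/(_ _ Vr)/forall_inP/(_ _ Wr)/forall_inP/(_ _ aV).
  move=> /forall_inP/(_ _ bW)/forall_inP/(_ _ cV)/forall_inP/(_ _ eW).
  by rewrite lt (negPf VW).
do 6![apply/forall_inP => ? ?]; apply/implyP => lt; apply/negPn/negP => ne.
exact: (nc _ _ _ _ ne _ _ _ _ _ _ _ _ lt).
Qed.

Lemma crossing_freeS V W V' W' : V' \subset V -> W' \subset W ->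
  crossing_free V W -> crossing_free V' W'.
Proof.
move=> /subsetP sV /subsetP sW cf a b c e aV bW cV eW.
by apply: (cf a b c e); [exact: sV | exact: sW | exact: sV | exact: sW].
Qed.

Definition nc_partition V := [set rho : part | partition rho V & noncrossing rho].

Variable wt : {set 'I_n} -> K.

(** The free moment-cumulant formula, with [wt B] in the role of the cumulant of the block [B]. *)
Definition nc_sum V := \sum_(rho in nc_partition V) \prod_(B in rho) wt B.

Lemma noncrossing_splitU rho V1 V2 :
  (forall B1 B2, B1 \in rho -> B2 \in rho -> B1 \subset V1 -> B2 \subset V2 ->
     crossing_free B1 B2 /\ crossing_free B2 B1) ->
  splits rho V1 V2 ->
  noncrossing rho = noncrossing (rho ::&: V1) && noncrossing (rho ::&: V2).
Proof.
move=> cf /forall_inP spl; apply/idP/idP.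
  move=> /noncrossingP nc; apply/andP; split; apply/noncrossingP => V W;
    by rewrite !in_restr => /andP[Vr _] /andP[Wr _]; exact: nc.
move=> /andP[/noncrossingP nc1 /noncrossingP nc2]; apply/noncrossingP => V W Vr Wr VW.
have /orP[s1|s1] := spl V Vr; have /orP[s2|s2] := spl W Wr.
- by apply: nc1 VW; rewrite in_restr ?Vr ?Wr.
- by have [] := cf V W Vr Wr s1 s2.
- by have [] := cf W V Wr Vr s2 s1.
- by apply: nc2 VW; rewrite in_restr ?Vr ?Wr.
Qed.

(** Taking the union of a partition of [V1] and one of [V2] is inverted by restriction, and the
    hypothesis on [Q1] and [Q2] keeps the union non-crossing. These predicates serve to prescribe a
    block or a coarser partition. *)
Lemma nc_sum_glue (Q1 Q2 : pred part) V1 V2 :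
  [disjoint V1 & V2] ->
  (forall r1 r2 B1 B2, Q1 r1 -> Q2 r2 -> B1 \in r1 -> B2 \in r2 ->
     B1 \subset V1 -> B2 \subset V2 -> crossing_free B1 B2 /\ crossing_free B2 B1) ->
  (\sum_(rho in nc_partition V1 | Q1 rho) \prod_(B in rho) wt B) *
  (\sum_(rho in nc_partition V2 | Q2 rho) \prod_(B in rho) wt B) =
  \sum_(rho in nc_partition (V1 :|: V2) |
      [&& splits rho V1 V2, Q1 (rho ::&: V1) & Q2 (rho ::&: V2)])
    \prod_(B in rho) wt B.
Proof.
move=> dV cf; rewrite big_distrlr /= pair_big /=.
rewrite (reindex_onto (fun rho : part => (rho ::&: V1, rho ::&: V2))
                      (fun p : part * part => p.1 :|: p.2)) /=; last first.
  move=> [r1 r2] /= /andP[/andP[+ _] /andP[+ _]]; rewrite !inE.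
  by move=> /andP[p1 _] /andP[p2 _]; have [-> ->] := restrU dV p1 p2.
apply: eq_big => [rho|rho].
  rewrite !inE; have := partition_splitU rho dV.
  case spl: (splits rho V1 V2); last first.
    rewrite !andbF /= => pE; apply/negP => /andP[].
    move=> /andP[/andP[/andP[p1 _] _] /andP[/andP[p2 _] _]] eqr.
    by rewrite p1 p2 eqr in pE.
  rewrite andbT => ->; case q1: (Q1 _); last by rewrite !andbF.
  case q2: (Q2 _); last by rewrite !andbF.
  rewrite (@noncrossing_splitU rho V1 V2 _ spl) => [|B1 B2 r1 r2 s1 s2].
    case: (partition (rho ::&: V1) V1); case: (partition (rho ::&: V2) V2) => //=;
    by case: (noncrossing (rho ::&: V1)); case: (noncrossing (rho ::&: V2));
       rewrite ?andbF ?andbT.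
  by apply: (cf _ _ B1 B2 q1 q2); rewrite ?in_restr ?r1 ?r2 ?s1 ?s2.
rewrite !inE => /andP[/andP[/andP[/andP[p1 _] _] /andP[/andP[p2 _] _]] /eqP rE].
rewrite -bigU /=; last first.
  rewrite -setI_eq0; apply/eqP/setP => B; rewrite inE !in_restr [RHS]inE.
  apply/negP => /andP[/andP[Br s1] /andP[_ s2]].
  have /partitionP[sub _ _] := p1.
  have [/set0Pn[x xB] _] : B != set0 /\ B \subset V1 by apply: sub; rewrite in_restr Br.
  by have := disjointFr dV (subsetP s1 _ xB); rewrite (subsetP s2 _ xB).
by apply: eq_bigl => B; rewrite -{3}rE [RHS]inE.
Qed.

(** Induction on the number of blocks of [pi]: one block [W] is split off, and its partitions are
    glued to those refining [pi :\ W]. No crossing arises, since sets lying in distinct blocks of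
    [pi] cannot cross. *)
Lemma nc_sum_prod (pi : part) V : pi \in nc_partition V ->
  \prod_(W in pi) nc_sum W =
  \sum_(rho in nc_partition V | refines rho pi) \prod_(B in rho) wt B.
Proof.
have [m] := ubnP #|pi|; elim: m pi V => // m IH pi V pim piV.
have [pi0|[W Wpi]] := set_0Vmem pi.
  rewrite pi0 in piV *; rewrite big_set0 (big_pred1 set0) ?big_set0 // => rho.
  move: piV; rewrite !inE /= => /andP[/partitionP[_ cov _] nc0].
  have V0 : V = set0.
    by apply/setP => x; rewrite inE; apply/negP => /cov[B]; rewrite inE.
  rewrite V0 partition_set0; case: eqP => //= ->; rewrite nc0 /=.
  by apply/forall_inP => B; rewrite inE.
have [ppi npi] : partition pi V /\ noncrossing pi by move: piV; rewrite inE => /andP[].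
have sWV : W \subset V by exact: partitionS ppi Wpi.
have pi'V : pi :\ W \in nc_partition (V :\: W).
  rewrite inE; apply/andP; split; first exact: partitionD1.
  apply/noncrossingP => A B; rewrite !inE => /andP[_ Ar] /andP[_ Br].
  by move/noncrossingP: npi; apply.
have dW : [disjoint W & V :\: W] by rewrite -setI_eq0 setIDA setDIl setDv set0I.
rewrite (big_setD1 W) //= (IH _ (V :\: W)) //; last first.
  by move: pim; rewrite (cardsD1 W) Wpi.
rewrite -[nc_sum W]big_condT -/(nc_sum W).
rewrite (@nc_sum_glue predT _ _ _ dW); last first.
  move=> r1 r2 B1 B2 _ /forall_inP rf _ /rf/exists_inP[W' W'pi sB2] sB1 _.
  move: W'pi; rewrite !inE => /andP[W'W W'pi].
  move/noncrossingP: npi => npi.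
  split; first by apply: crossing_freeS (npi W W' _ _ _); rewrite // eq_sym.
  exact: crossing_freeS (npi W' W _ _ _).
have -> : W :|: V :\: W = V.
  by apply/setP => x; rewrite !inE; case: (boolP (x \in W)) => // /(subsetP sWV).
apply: eq_bigl => rho; rewrite !inE; case prho: (partition rho V) => //=.
case: (noncrossing rho) => //=.
apply/andP/forall_inP => [[/forall_inP spl /forall_inP rf] B Br|rf].
  have /orP[sB|sB] := spl B Br; first by apply/exists_inP; exists W.
  have /rf/exists_inP[W' + BW'] : B \in rho ::&: (V :\: W) by rewrite in_restr Br.
  by rewrite inE => /andP[_ W'pi]; apply/exists_inP; exists W'.
have dj A : A \in pi -> A != W -> A \subset V :\: W.
  move=> Api AW; rewrite subsetD (partitionS ppi Api) /=.
  by move/trivIsetP: (partition_trivIset ppi); apply.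
split; apply/forall_inP => B.
  move=> /rf/exists_inP[A Api BA]; case: (eqVneq A W) => [<-|AW]; first by rewrite BA.
  by apply/orP; right; exact: subset_trans BA (dj A Api AW).
rewrite in_restr => /andP[Br sB]; have /exists_inP[A Api BA] := rf B Br.
apply/exists_inP; exists A => //; rewrite !inE Api andbT.
have [/set0Pn[x xB] _] : B != set0 /\ B \subset V.
  by split; [exact: partition_neq0 prho Br | exact: partitionS prho Br].
apply/eqP => AW; have := subsetP sB _ xB.
by rewrite inE -AW (subsetP BA _ xB).
Qed.

End NonCrossingSums.

(** * Non-crossing partitions into pairs *)

Section NonCrossingPairings.
Variables (K : comNzRingType) (n : nat) (w : 'I_n -> 'I_n -> K).
Implicit Types (V W B : {set 'I_n}).

(* Vanishes unless [B] has two elements. *)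
Definition pair_weight B : K :=
  \sum_(p : 'I_n * 'I_n | (p.1 < p.2)%N && (B == [set p.1; p.2])) w p.1 p.2.

Lemma pair_weight2 (x y : 'I_n) : (x < y)%N -> pair_weight [set x; y] = w x y.
Proof.
move=> xy; rewrite /pair_weight (big_pred1 (x, y)) // => -[a b] /=.
rewrite xpair_eqE; apply/idP/idP => [/andP[ab /eqP E]|/andP[/eqP -> /eqP ->]].
  have := set21 a b; have := set22 a b; rewrite -E !inE.
  by move=> /orP[] /eqP ? /orP[] /eqP ?; subst; rewrite ?eqxx //; lia.
by rewrite xy eqxx.
Qed.

Lemma pair_weight_eq0 B :
  (forall x y : 'I_n, (x < y)%N -> B != [set x; y]) -> pair_weight B = 0.
Proof.
move=> BN; rewrite /pair_weight big_pred0 // => -[a b] /=.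
by case: ltnP => //= ab; rewrite (negPf (BN _ _ ab)).
Qed.

Local Notation F := (nc_sum pair_weight).

(** Since [x] is minimal in [V], another block that does not cross [[set x; y]] lies either strictly
    between [x] and [y] or beyond [y]. So the sum is obtained by gluing the pair, the inside and the
    outside. *)
Let nc_sum_through V (x y : 'I_n) : (x < y)%N -> x \in V -> y \in V ->
  (forall z, z \in V -> z != x -> (x < z)%N) ->
  \sum_(rho in nc_partition V | [set x; y] \in rho) \prod_(B in rho) pair_weight B =
  w x y * F [set z in V | (x < z < y)%N] * F [set z in V | (y < z)%N].
Proof.
move=> xy xV yV minx; set Vi := [set z in V | _]; set Vo := [set z in V | _].
pose xyV := [set x; y].
have F2 : w x y = \sum_(rho in nc_partition xyV | rho == [set xyV])
    \prod_(B in rho) pair_weight B.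
  rewrite (big_pred1 [set xyV]) ?big_set1 ?pair_weight2 // => rho /=.
  case: eqP => [->|]; rewrite ?andbF // andbT inE; apply/andP; split.
    apply/partitionP; split => [B|z zV|B B' z].
    - by rewrite inE => /eqP ->; split => //; apply/set0Pn; exists x; rewrite set21.
    - by exists xyV; rewrite ?set11.
    - by rewrite !inE => /eqP -> /eqP ->.
  by apply/noncrossingP => B B'; rewrite !inE => /eqP -> /eqP ->; rewrite eqxx.
have di : [disjoint xyV & Vi].
  rewrite -setI_eq0; apply/eqP/setP => z; rewrite !inE; apply/negP.
  by move=> /andP[/orP[] /eqP -> /and3P[_]]; rewrite ltnn ?andbF.
have dio : [disjoint xyV :|: Vi & Vo].
  rewrite -setI_eq0; apply/eqP/setP => z; rewrite !inE; apply/negP.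
  move=> /andP[+ /andP[_ yz]] => /orP[/orP[] /eqP E|/and3P[_ _ zy]]; subst; lia.
rewrite {1}F2 -[F Vi]big_condT (@nc_sum_glue _ _ _ _ predT _ _ di); last first.
  move=> r1 r2 B1 B2 /eqP-> _ + _ _ /subsetP sB2; rewrite inE => /eqP -> {B1}.
  split=> a b c e; rewrite !inE => aB bB cB eB /andP[/andP[ab bc] ce].
    move: (sB2 _ bB) (sB2 _ eB); rewrite !inE => /and3P[_ ? ?] /and3P[_ ? ?].
    by case/orP: cB => /eqP ?; subst c; lia.
  move: (sB2 _ aB) (sB2 _ cB); rewrite !inE => /and3P[_ ? ?] /and3P[_ ? ?].
  by case/orP: bB => /eqP ?; subst b; lia.
have restr (rho : {set {set 'I_n}}) : (xyV \in rho) = (xyV \in rho ::&: xyV).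
  by rewrite in_restr subxx andbT.
have uniqB (rho : {set {set 'I_n}}) (W : {set 'I_n}) B : partition rho W -> xyV \in rho ->
    B \in rho -> B != xyV -> (x \notin B) && (y \notin B).
  move=> /partitionP[_ _ triv] xyr Br ne; apply/andP; split; apply/negP => zB;
    by case/eqP: ne; apply: (triv _ _ _ Br xyr zB); rewrite !inE eqxx ?orbT.
rewrite [X in _ = X * _](eq_bigl (fun rho : {set {set 'I_n}} =>
    (rho \in nc_partition (xyV :|: Vi)) && (xyV \in rho))); last first.
  move=> rho; rewrite inE -andbA; case prho: (partition rho _) => //=.
  case: (noncrossing rho) => //=; apply/and3P/idP => [[_ /eqP E _]|xyr].
    by rewrite restr E set11.
  have oth B : B \in rho -> B != xyV -> B \subset Vi.
    move=> Br ne; have /andP[xB yB] := uniqB _ _ _ prho xyr Br ne.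
    have := partitionS prho Br => /subsetP sB; apply/subsetP => z zB.
    have := sB _ zB; rewrite !inE => /orP[/orP[]/eqP E|//]; first by rewrite E (negPf xB) in zB.
    by rewrite E (negPf yB) in zB.
  split => //.
    by apply/forall_inP => B Br; case: (eqVneq B xyV) => [->|ne]; rewrite ?subxx // oth ?orbT.
  apply/eqP/setP => B; rewrite in_restr inE; apply/idP/eqP => [/andP[Br sB]|->].
    case: (eqVneq B xyV) => // ne; have /set0Pn[z zB] := partition_neq0 prho Br.
    by have := disjointFr di (subsetP sB _ zB); rewrite (subsetP (oth _ Br ne) _ zB).
  by rewrite xyr subxx.
rewrite -[F Vo]big_condT (@nc_sum_glue _ _ _
    (fun rho : {set {set 'I_n}} => xyV \in rho) predT _ _ dio); last first.
  move=> r1 r2 B1 B2 _ _ _ _ /subsetP sB1 /subsetP sB2.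
  have lt a b : a \in B1 -> b \in B2 -> (a < b)%N.
    move=> /sB1 + /sB2; rewrite !inE => /orP[/orP[]/eqP E|/and3P[_ _ ?]] /andP[_ ?]; subst; lia.
  split=> a b c e aB bB cB eB /andP[/andP[ab bc] ce].
    by have := lt _ _ cB bB; lia.
  by have := lt _ _ bB aB; lia.
have VE : xyV :|: Vi :|: Vo = V.
  apply/setP => z; rewrite !inE; apply/idP/idP.
    by move=> /orP[/orP[/orP[]/eqP->|/and3P[]]|/andP[]].
  move=> zV; rewrite zV /=; case: (eqVneq z x) => //= zx; rewrite (minx _ zV zx) /=.
  by case: (ltngtP z y) => [_|_|/val_inj ->]; rewrite ?eqxx ?orbT.
rewrite VE; apply: eq_bigl => rho; rewrite inE.
case prho: (partition rho V) => //=; case nc: (noncrossing rho) => //=.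
have sub : xyV \subset xyV :|: Vi by rewrite subsetUl.
apply/idP/and3P => [xyr|[_ + _]]; last by rewrite in_restr => /andP[].
split => //; last by rewrite in_restr xyr.
apply/forall_inP => B Br; case: (eqVneq B xyV) => [->|ne]; first by rewrite sub.
have /andP[xB yB] := uniqB _ _ _ prho xyr Br ne.
have /subsetP sB := partitionS prho Br.
(* A block with an element [b] before [y] stays before [y]: an element [z] beyond [y] would give the
   crossing [x < b < y < z]. *)
have [/exists_inP[b bB by_]|nb] := boolP [exists b in B, (b < y)%N]; last first.
  apply/orP; right; apply/subsetP => z zB; rewrite inE sB //=.
  case: (ltngtP y z) => // [zy|/val_inj E]; last by rewrite E zB in yB.
  by case/negP: nb; apply/exists_inP; exists z.
apply/orP; left; apply/subsetP => z zB; rewrite !inE sB //=.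
have zx : z != x by apply: contraNneq xB => <-.
have bx : b != x by apply: contraNneq xB => <-.
rewrite (minx _ (sB _ zB) zx) /=.
case: (ltngtP z y) => [_|yz|/val_inj ->]; rewrite ?eqxx ?orbT //.
move/noncrossingP: nc => /(_ _ _ xyr Br); rewrite eq_sym => /(_ ne x b y z).
rewrite set21 set22 => /(_ isT bB isT zB) []; rewrite yz by_ andbT /= andbT.
exact: minx (sB _ bB) bx.
Qed.

(** The partitions are sorted by the block of the minimum [x]; only those in which this block is a
    pair can contribute. *)
Lemma nc_sum_pair_rec V (x : 'I_n) : x \in V ->
  (forall z, z \in V -> z != x -> (x < z)%N) ->
  F V = \sum_(y in V | (x < y)%N)
    w x y * F [set z in V | (x < z < y)%N] * F [set z in V | (y < z)%N].
Proof.
move=> xV minx.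
rewrite (eq_bigr (fun y => \sum_(rho in nc_partition V | [set x; y] \in rho)
  \prod_(B in rho) pair_weight B)); last first.
  by move=> y /andP[yV xy]; rewrite nc_sum_through.
rewrite (exchange_big_dep (mem (nc_partition V))) /=; last by move=> y rho _ /andP[].
apply: eq_bigr => rho; rewrite inE => /andP[prho nrho].
have /partitionP[sub cov triv] := prho; have [B Br xB] := cov x xV.
have [[y [yV xy BE]]|no] := pselect (exists y, [/\ y \in V, (x < y)%N & B = [set x; y]]).
  rewrite (big_pred1 y) // => z; rewrite inE prho nrho /=.
  apply/idP/eqP => [/andP[/andP[zV xz] xzr]|->]; last by rewrite yV xy -BE Br.
  have := set22 x z; rewrite (triv _ _ x xzr Br) ?set21 // BE !inE.
  by case/orP => /eqP // zx; rewrite zx ltnn in xz.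
rewrite (bigD1 B) //= pair_weight_eq0 ?mul0r; last first.
  move=> a b ab; apply/eqP => E; apply: no.
  have sB : B \subset V by have [] := sub B Br.
  have aV : a \in V by apply: (subsetP sB); rewrite E set21.
  have bV : b \in V by apply: (subsetP sB); rewrite E set22.
  exists b; move: xB; rewrite {1}E !inE => /orP[/eqP xa|/eqP xb]; first by subst a.
  by have := minx a aV; rewrite xb => /(_ _); case: eqP => [E'|_ /(_ isT)];
    [rewrite E' ltnn in ab|lia].
rewrite big1 // => y /andP[/andP[yV xy] /andP[_ xyr]]; case: no; exists y; split => //.
Qed.

Lemma split_sum_mid (s : seq 'I_n) (H : 'I_n -> K) :
  split_sum s (fun _ y _ => H y) = \sum_(y <- s) H y.
Proof. by elim: s => [|y s IH] /=; rewrite ?big_nil // big_cons IH. Qed.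

(** In an increasing list the segments before and after the partner [y] of the first letter [x]
    enumerate the elements between [x] and [y] and those beyond [y], so both recursions coincide. *)
Lemma nc_sum_pairing (s : seq 'I_n) : sorted (fun i j : 'I_n => i < j)%N s ->
  F [set i in s] = nc_pairing_sum w s.
Proof.
have ltr : transitive (fun i j : 'I_n => i < j)%N by move=> a b c; exact: ltn_trans.
have [m] := ubnP (size s); elim: m s => // m IH [|x s] sm ss.
  rewrite nc_pairing_sum_nil /nc_sum (big_pred1 set0) ?big_set0 // => rho /=.
  rewrite inE (_ : [set i in [::]] = set0 :> {set 'I_n}); last first.
    by apply/setP => i; rewrite !inE.
  rewrite partition_set0; case: eqP => //= ->.
  by apply/noncrossingP => B B'; rewrite inE.
have us : uniq (x :: s) by apply: (sorted_uniq ltr _ ss) => i; rewrite ltnn.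
have xs z : z \in s -> (x < z)%N.
  by move: ss; rewrite /= path_sortedE // => /andP[/allP + _]; apply.
rewrite (@nc_sum_pair_rec _ x) ?inE ?eqxx //; last first.
  by move=> z; rewrite !inE => /predU1P[->|/xs //]; rewrite eqxx.
rewrite nc_pairing_sum_cons.
under eq_split_sum => a y b sE.
  have : sorted (fun i j : 'I_n => (i < j)%N) (a ++ y :: b).
    by rewrite -sE; exact: path_sorted ss.
  rewrite sorted_pairwise // pairwise_cat /= => /and3P[ayb pa /andP[yb pb]].
  have sa : (size a < m)%N by move: sm; rewrite sE /= size_cat /=; lia.
  have sb : (size b < m)%N by move: sm; rewrite sE /= size_cat /=; lia.
  have ay z : z \in a -> (z < y)%N.
    by move: ayb; rewrite allrel_consr => /andP[/allP + _]; apply.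
  have yb' z : z \in b -> (y < z)%N by move/allP: yb; apply.
  rewrite -(IH a sa) -?(IH b sb) ?sorted_pairwise //.
  rewrite (_ : [set i in a] = [set z in [set i in x :: s] | (x < z < y)%N]); last first.
    apply/setP => z; rewrite !inE sE mem_cat inE; apply/idP/idP.
      by move=> za; rewrite za ay // xs ?orbT // sE mem_cat za.
    move=> /and3P[/predU1P[->|/or3P[//|/eqP->|/yb' ?]]]; rewrite ?ltnn //; lia.
  rewrite (_ : [set i in b] = [set z in [set i in x :: s] | (y < z)%N]); last first.
    apply/setP => z; rewrite !inE sE mem_cat inE; apply/idP/idP.
      by move=> zb; rewrite zb yb' // !orbT.
    have xy : (x < y)%N by apply: xs; rewrite sE mem_cat inE eqxx orbT.
    by move=> /andP[/predU1P[->|/or3P[/ay ?|/eqP->|//]]]; rewrite ?ltnn //; lia.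
  over.
rewrite split_sum_mid big_uniq /=; last by case/andP: us.
apply: eq_bigl => y; rewrite !inE; apply/andP/idP => [[/predU1P[->|//]]|ys].
  by rewrite ltnn.
by rewrite ys orbT xs.
Qed.

End NonCrossingPairings.

(** * Moments of a bi-free central limit distribution *)

Section Inversion.

(** Enumerating [L] turns [M] and [Z] into square matrices, and a one-sided inverse of a square
    matrix over a commutative ring is two-sided. *)
Lemma incidence_inverseC (T : finType) (L : {set T}) (M Z : T -> T -> int) :
  {in L &, forall x y, \sum_(z in L) M x z * Z z y = (x == y)%:R} ->
  {in L &, forall x y, \sum_(z in L) Z x z * M z y = (x == y)%:R}.
Proof.
move=> MZ x y xL yL.
have sumE (f : T -> int) : \sum_(z in L) f z = \sum_(i < #|L|) f (enum_val i).
  by rewrite -big_enum_val.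
pose A := \matrix_(i < #|L|, j < #|L|) M (enum_val i) (enum_val j).
pose B := \matrix_(i < #|L|, j < #|L|) Z (enum_val i) (enum_val j).
have AB : A *m B = 1%:M.
  apply/matrixP => i j; rewrite !mxE.
  transitivity (\sum_(z in L) M (enum_val i) z * Z z (enum_val j)).
    by rewrite sumE; apply: eq_bigr => k _; rewrite !mxE.
  by rewrite MZ ?enum_valP // (inj_eq enum_val_inj).
have /matrixP/(_ (enum_rank_in xL x) (enum_rank_in xL y)) := mulmx1C AB.
have -> : 1%:M (enum_rank_in xL x) (enum_rank_in xL y) = (x == y)%:R :> int.
  rewrite mxE; congr (nat_of_bool _)%:R; apply/eqP/eqP => [E|xy]; last first.
    exact: (congr1 (enum_rank_in xL) xy).
  by have := congr1 enum_val E; rewrite !enum_rankK_in.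
rewrite mxE => <-.
rewrite sumE; apply: eq_bigr => k _.
by rewrite !mxE !enum_rankK_in.
Qed.

Variable n : nat.

(** [NC_mobius_sum] sums over the second argument of the Moebius function; here the sum runs over
    the first, which is the other of the two inverse relations with the zeta function. *)
Lemma NC_mobius_sum_top (rho : {set {set 'I_n}}) : rho \in NC n -> NC_top n \in NC n ->
  \sum_(pi in NC n | refines rho pi) NC_mobius pi (NC_top n) = (rho == NC_top n)%:R.
Proof.
move=> rNC tNC.
have MZ : {in NC n &, forall x y, \sum_(z in NC n)
    (if refines x z then NC_mobius x z else 0) * (refines z y)%:R = (x == y)%:R}.
  move=> x y xN yN; have [xy|nxy] := boolP (refines x y).
    rewrite -(NC_mobius_sum xN yN xy) [RHS]big_mkcondr /=; apply: eq_bigr => z _.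
    by case: (refines x z); case: (refines z y); rewrite ?mulr1 ?mulr0 ?mul0r.
  rewrite big1 => [|z zN].
    by case: eqP => // E; case/negP: nxy; rewrite E; exact: (refines_refl yN).
  case: ifP => xz; rewrite ?mul0r //; case: (boolP (refines z y)) => zy; rewrite ?mulr0 //.
  by case/negP: nxy; exact: (refines_trans zN xN yN xz zy).
rewrite -(incidence_inverseC MZ rNC tNC) big_mkcondr /=; apply: eq_bigr => z zN.
have top : refines z (NC_top n).
  by apply/forall_inP => V _; apply/exists_inP; exists [set: 'I_n]; rewrite ?set11 ?subsetT.
by rewrite top; case: (refines rho z); rewrite ?mul1r ?mul0r.
Qed.

Lemma NC_mobius_refl (pi : {set {set 'I_n}}) : pi \in NC n -> NC_mobius pi pi = 1.
Proof.
move=> piN; rewrite /NC_mobius /mobius.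
by have : (0 < #|NC n|)%N; [apply/card_gt0P; exists pi | case: #|NC n| => //= k; rewrite eqxx].
Qed.

Lemma NC_topP : (0 < n)%N -> NC_top n \in NC n.
Proof.
move=> n0; rewrite inE; apply/andP; split.
  apply/partitionP; split => [B|x _|B B' x]; rewrite ?inE.
  - move=> /eqP ->; split => //; apply/set0Pn; exists (Ordinal n0); exact: in_setT.
  - by exists setT; rewrite ?set11 ?inE.
  - by move=> /eqP -> /eqP ->.
by apply/noncrossingP => B B'; rewrite !inE => /eqP -> /eqP ->; rewrite eqxx.
Qed.

Variables (K : comNzRingType) (w : 'I_n -> 'I_n -> K).

Lemma nc_partition_setT : nc_partition [set: 'I_n] = NC n.
Proof. by apply/setP => rho; rewrite !inE. Qed.

(** Expanding each product over the partitions [rho] refining [pi] and exchanging the sums leaves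
    only the term of [NC_top n], the weight of the full set, which is not a pair as [n <> 2]. *)
Lemma nc_pairing_sum_cumulant : (0 < n)%N -> n <> 2 ->
  \sum_(pi in NC n) (\prod_(V in pi) nc_sum (pair_weight w) V) *
    (NC_mobius pi (NC_top n))%:~R = 0.
Proof.
move=> n0 n2; have tN := NC_topP n0.
transitivity (\sum_(rho in NC n) (\prod_(B in rho) pair_weight w B) *
    (\sum_(pi in NC n | refines rho pi) NC_mobius pi (NC_top n))%:~R).
  rewrite (eq_bigr (fun pi => \sum_(rho in NC n | refines rho pi)
      (\prod_(B in rho) pair_weight w B) * (NC_mobius pi (NC_top n))%:~R)); last first.
    move=> pi piN; rewrite (@nc_sum_prod _ _ _ _ setT) ?nc_partition_setT //.
    by rewrite mulr_suml.
  rewrite (exchange_big_dep (mem (NC n))) /=; last by move=> pi rho _ /andP[].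
  apply: eq_bigr => rho rN; rewrite rmorph_sum mulr_sumr; apply: eq_bigl => pi.
  by rewrite rN.
rewrite big1 // => rho rN; rewrite NC_mobius_sum_top //; case: eqP => [->|_]; last by rewrite mulr0.
rewrite /NC_top big_set1 pair_weight_eq0 ?mul0r // => x y xy; apply: contra_notN n2 => /eqP E.
by rewrite -(card_ord n) -cardsT E cards2 neq_ltn xy.
Qed.

End Inversion.

(** * Bi-free cumulants as sums over non-crossing partitions *)

Section BiFree.
Variables (n : nat) (chi : 'I_n -> bool).

Lemma part_imageK (s : {perm 'I_n}) (pi : {set {set 'I_n}}) :
  part_image s^-1 (part_image s pi) = pi.
Proof.
rewrite /part_image -imset_comp (eq_imset (g := id)) ?imset_id // => V /=.
by rewrite -imset_comp (eq_imset (g := id)) ?imset_id // => x /=; rewrite permK.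
Qed.

Lemma part_image_inj (s : {perm 'I_n}) : injective (part_image s).
Proof. exact: can_inj (part_imageK s). Qed.

Lemma bifree_cumulantE (C : comNzRingType) (A : lalgType C) (phi : A -> C) (a : 'I_n -> A) :
  bifree_cumulant chi phi a =
  \sum_(pi in NC n) (\prod_(V in pi) phi (\prod_(i in s_perm chi @: V) a i)) *
     (NC_mobius pi (NC_top n))%:~R.
Proof.
rewrite /bifree_cumulant /BNC big_imset /=; last by move=> p q _ _; exact: part_image_inj.
apply: eq_bigr => pi _; rewrite part_imageK; congr (_ * _).
rewrite /phi_part /part_image big_imset //= => V W _ _.
by apply: (imset_inj (f := s_perm chi)) => x y; exact: perm_inj.
Qed.

(* The values of [s_chi] on an increasing enumeration of [V] list the left
   elements of [s_chi V] in increasing order, then the right ones in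
   decreasing order. *)
Lemma s_perm_enum (V : {set 'I_n}) :
  [seq i <- enum (s_perm chi @: V) | chi i] ++
    rev [seq i <- enum (s_perm chi @: V) | ~~ chi i] =
  map (s_perm chi) (enum V).
Proof.
have enumE (W : {set 'I_n}) : enum W = [seq x <- enum 'I_n | x \in W] by rewrite enumT.
have sE : s_seq chi = map (s_perm chi) (enum 'I_n).
  have sz := size_s_seq chi; case sx: (s_seq chi) => [|x0 t].
    by apply/esym/size0nil; rewrite size_map size_enum_ord -sz sx.
  rewrite -sx; apply: (@eq_from_nth _ x0); first by rewrite sz size_map size_enum_ord.
  move=> k; rewrite sz => kn; rewrite (nth_map x0) ?size_enum_ord // permE /s_fun.
  rewrite (nth_ord_enum x0 (Ordinal kn)) /=.
  by apply: set_nth_default; rewrite sz.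
transitivity [seq i <- s_seq chi | i \in s_perm chi @: V].
  rewrite /s_seq filter_cat filter_rev (enumE (_ @: _)) -!filter_predI.
  by congr (_ ++ rev _); apply: eq_filter => i /=; congr (_ && _); rewrite andbC.
rewrite sE filter_map (enumE V); congr map; apply: eq_filter => i /=.
exact: mem_imset (@perm_inj _ _).
Qed.

End BiFree.

Section CentralLimit.
Variables (R : realType) (I J : Type) (c : I + J -> I + J -> R[i]).
Local Notation C := R[i].
Hypothesis c_sym : forall k l, c k l = c l k.
Variables (A : algType C) (phi : {scalar A}) (a : I + J -> A).
Hypothesis phi1 : phi 1 = 1.
Hypothesis a_clt : bifree_clt phi a c.

(* The letters of [w] in the order [s_chi(1), ..., s_chi(n)]. *)
Definition left_right (w : seq (I + J)) : seq (I + J) :=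
  [seq k <- w | Defs.is_left k] ++ rev [seq k <- w | ~~ Defs.is_left k].

(** Strong induction on the length. Apart from length 2, which is read off the covariance, the
    cumulants on both sides vanish, and their terms for partitions other than the top one agree by
    induction. The top term is the moment itself, with Moebius coefficient 1, so the moments agree
    too. *)
Lemma bifree_clt_moment (w : seq (I + J)) :
  phi (\prod_(k <- w) a k) = nc_pairing_sum c (left_right w).
Proof.
have [m] := ubnP (size w); elim: m w => // m IH w wm.
case: (eqVneq (size w) 2) => [w2|w2].
  case: w w2 {IH wm} => [|k [|l []]] // _; rewrite !big_cons big_nil mulr1.
  rewrite -a_clt.2 /left_right.
  have nc2 x y : nc_pairing_sum c [:: x; y] = c x y.
    by rewrite nc_pairing_sum_cons /= !nc_pairing_sum_nil addr0 !mulr1.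
  (* [left_right] swaps the two letters exactly when the first is a right one; the symmetry of [c]
     covers this case. *)
  by case: k l => [i|j] [i'|j'] /=; rewrite nc2 // c_sym.
have [/size0nil ->|n0] := posnP (size w).
  by rewrite big_nil /left_right /= nc_pairing_sum_nil.
pose n := size w; pose alpha (i : 'I_n) := tnth (in_tuple w) i.
pose chi i := Defs.is_left (alpha i); pose s := s_perm chi.
pose beta i := alpha (s i).
have wE : w = map alpha (enum 'I_n) by rewrite map_tnth_enum.
have lrE (V : {set 'I_n}) : left_right (map alpha (enum (s @: V))) = map beta (enum V).
  rewrite /beta [map _ (enum V)]map_comp -s_perm_enum map_cat map_rev /left_right !filter_map.
  by [].
pose F := nc_sum (pair_weight (fun i j => c (beta i) (beta j))).
have FE V : F V = nc_pairing_sum c (map beta (enum V)).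
  rewrite nc_pairing_sum_map -nc_sum_pairing; last first.
    have : sorted ltn (map val (enum 'I_n)) by rewrite val_enum_ord iota_ltn_sorted.
    rewrite sorted_map => st; have -> : enum V = [seq i <- enum 'I_n | i \in V] by rewrite enumT.
    apply: sorted_filter => //.
    by move=> x y z; exact: ltn_trans.
  by congr nc_sum; apply/setP => i; rewrite inE mem_enum.
pose M (V : {set 'I_n}) := phi (\prod_(i in s @: V) a (alpha i)).
have ME V : M V = phi (\prod_(k <- map alpha (enum (s @: V))) a k).
  rewrite /M big_map; have -> : enum (s @: V) = [seq i <- index_enum 'I_n | i \in s @: V].
    by rewrite [index_enum _]unlock.
  by rewrite big_filter.
have MF V : V != setT -> M V = F V.
  move=> VT; rewrite ME FE -lrE IH // size_map -cardE card_imset; last exact: perm_inj.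
  have : (#|V| < #|[set: 'I_n]|)%N by apply: proper_card; rewrite properEneq VT subsetT.
  by rewrite cardsT card_ord => /leq_trans; apply; rewrite -ltnS.
have n2 : n <> 2 by apply/eqP.
have n13 : (n = 1 \/ 3 <= n)%N.
  by move: n0 n2; rewrite -/n; case: (n) => [|[|[|]]] // *; [left | right].
have := a_clt.1 n alpha; rewrite bifree_cumulantE => a_clt0.
have := etrans (a_clt0 n13)
  (esym (nc_pairing_sum_cumulant (fun i j => c (beta i) (beta j)) n0 n2)).
have tN := NC_topP n0.
rewrite (bigD1 _ tN) /= [RHS](bigD1 _ tN) /= => E.
have : M setT = F setT.
  move: E; rewrite !NC_mobius_refl // !mulr1 /NC_top !big_set1.
  rewrite (eq_bigr (fun pi : {set {set 'I_n}} =>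
      (\prod_(V in pi) F V) * (NC_mobius pi (NC_top n))%:~R)).
    by move/addIr.
  move=> pi /andP[piN pi1]; congr (_ * _); apply: eq_bigr => V Vpi; apply: MF.
  (* A partition having the full set as a block is [NC_top n]. *)
  apply: contraNneq pi1 => VT; rewrite VT in Vpi.
  have : pi \in NC n by exact: piN.
  rewrite inE => /andP[/partitionP[sub _ triv] _].
  apply/eqP/setP => B; rewrite inE; apply/idP/eqP => [Bpi|-> //].
  have [/set0Pn[x xB] _] := sub B Bpi.
  by apply: (triv B setT x) => //; rewrite inE.
rewrite ME FE -lrE (_ : s @: setT = setT); last first.
  by apply/setP => i; rewrite inE -(permKV s i) mem_imset ?inE //; exact: perm_inj.
rewrite (_ : enum setT = enum 'I_n); last by apply: eq_enum => i; rewrite inE.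
by rewrite -wE.
Qed.

End CentralLimit.

(** * Closed walks *)

Section Walks.
Variables (L : Type) (N : nat).
(* A step [(a, x, y)] goes from [x] to [y] and carries the label [a]. *)
Local Notation step := (L * 'I_N * 'I_N)%type.
Implicit Types (u : seq L) (s p q : seq step) (x y z v : 'I_N).

Definition labels s : seq L := [seq t.1.1 | t <- s].
Definition targets s : seq 'I_N := [seq t.2 | t <- s].

Fixpoint is_walk x z s : bool :=
  if s is t :: s' then (t.1.2 == x) && is_walk t.2 z s' else x == z.

Lemma is_walk_cat x z s1 s2 : is_walk x z (s1 ++ s2) =
  is_walk x (last x (targets s1)) s1 && is_walk (last x (targets s1)) z s2.
Proof. by elim: s1 x => [|t s1 IH] x /=; rewrite ?eqxx // IH andbA. Qed.

Lemma is_walk_last x z s : is_walk x z s -> last x (targets s) = z.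
Proof. by elim: s x => [|t s IH] x /= => [/eqP|/andP[_ /IH]]. Qed.

Lemma is_walk_avoid x z s v : is_walk x z s -> v != x -> v \notin targets s ->
  all (fun t => (t.1.2 != v) && (t.2 != v)) s.
Proof.
elim: s x => //= t s IH x /andP[/eqP <- wk] vx.
rewrite inE negb_or => /andP[vt vs]; rewrite eq_sym vx eq_sym vt /=.
exact: IH wk _ vs.
Qed.

Section WalkSums.
Variable K : comNzRingType.
Implicit Types F G : seq step -> K.

(** The continuation [F] receives each walk from [x] to [z] with label word [u]; the summation
    variables are its vertices after [x]. *)
Fixpoint walk_sum u x z F : K :=
  if u is a :: u' then \sum_y walk_sum u' y z (fun s => F ((a, x, y) :: s))
  else if x == z then F [::] else 0.

Lemma eq_walk_sum u x z F G :
  (forall s, labels s = u -> is_walk x z s -> F s = G s) ->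
  walk_sum u x z F = walk_sum u x z G.
Proof.
elim: u x F G => [|a u IH] x F G FG /=.
  by case: eqP => // xz; apply: FG => //=; rewrite xz eqxx.
apply: eq_bigr => y _; apply: IH => s su wk; apply: FG; rewrite /= ?su //.
by rewrite eqxx.
Qed.

Lemma walk_sum0 u x z : walk_sum u x z (fun=> 0) = 0.
Proof.
elim: u x => [|a u IH] x /=; first by case: eqP.
by rewrite big1 // => y _; rewrite IH.
Qed.

Lemma walk_sumD u x z F G :
  walk_sum u x z (fun s => F s + G s) = walk_sum u x z F + walk_sum u x z G.
Proof.
elim: u x F G => [|a u IH] x F G /=; first by case: eqP; rewrite ?addr0.
by rewrite -big_split; apply: eq_bigr => y _; rewrite IH.
Qed.

Lemma walk_sumZ u x z k F :
  walk_sum u x z (fun s => k * F s) = k * walk_sum u x z F.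
Proof.
elim: u x F => [|a u IH] x F /=; first by case: eqP; rewrite ?mulr0.
by rewrite mulr_sumr; apply: eq_bigr => y _; rewrite IH.
Qed.

Lemma walk_sumB u x z F G :
  walk_sum u x z (fun s => F s - G s) = walk_sum u x z F - walk_sum u x z G.
Proof.
rewrite walk_sumD -mulN1r -walk_sumZ; congr (_ + _).
by apply: eq_walk_sum => s _ _; rewrite mulN1r.
Qed.

Lemma walk_sum_split u y z (F : seq step -> step -> seq step -> K) :
  walk_sum u y z (fun s => split_sum s F) =
  split_sum u (fun u1 b u2 => \sum_p \sum_q
    walk_sum u1 y p (fun s1 => walk_sum u2 q z (fun s2 => F s1 (b, p, q) s2))).
Proof.
elim: u y F => [|a u IH] y F /=; first by case: eqP.
under eq_bigr do rewrite walk_sumD IH.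
rewrite big_split /= split_sum_exchange; congr (_ + _).
  apply: esym; rewrite (bigD1 y) //= [X in _ + X]big1 ?addr0.
    by apply: eq_bigr => q _; rewrite eqxx.
  by move=> p py; rewrite big1 // => q _; rewrite eq_sym (negPf py).
apply: eq_split_sum => u1 b u2 _.
by rewrite exchange_big; apply: eq_bigr => p _; rewrite exchange_big.
Qed.

Lemma walk_sum_mulmx (X : L -> 'M[K]_N) u x z :
  foldr (fun a M => X a *m M) 1%:M u x z =
  walk_sum u x z (fun s => \prod_(t <- s) X t.1.1 t.1.2 t.2).
Proof.
elim: u x => [|a u IH] x /=; first by rewrite mxE big_nil; case: eqP.
rewrite mxE; apply: eq_bigr => y _; rewrite IH -walk_sumZ.
by apply: eq_walk_sum => s _ _; rewrite big_cons.
Qed.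

Variables (c : L -> L -> K) (k : K).
Hypothesis kN : N%:R * k = 1.

(* Only opposite traversals of the same edge are paired; [k] will be [1 / N],
   which offsets the sum over the free endpoint of the edge. *)
Definition reverse_weight (t t' : step) : K :=
  if (t.2 == t'.1.2) && (t.1.2 == t'.2) then k * c t.1.1 t'.1.1 else 0.

(** If the first step, from [x] to [y], is paired with a reverse step, the walk in between is closed
    at [y] and the rest leads from [x] to [z]. The result no longer depends on [y], so summing over
    [y] gives the factor [N%:R * k = 1]. *)
Lemma walk_sum_nc u x z :
  walk_sum u x z (nc_pairing_sum reverse_weight) =
  (x == z)%:R * nc_pairing_sum c u.
Proof.
have [m] := ubnP (size u); elim: m u x z => // m IH [|a u] x z um.
  by rewrite /= !nc_pairing_sum_nil mulr1; case: eqP.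
rewrite /= (eq_bigr (fun y => split_sum u (fun u1 b u2 =>
    k * (c a b * ((x == z)%:R * (nc_pairing_sum c u1 * nc_pairing_sum c u2)))))).
  rewrite sumr_const card_ord -[_ *+ N]mulr_natl nc_pairing_sum_cons !mulr_split_sumr.
  by apply: eq_split_sum => u1 b u2 _; rewrite mulrA kN; ring.
move=> y _.
rewrite (@eq_walk_sum _ _ _ _ (fun s => split_sum s (fun s1 t s2 => reverse_weight (a, x, y) t *
  nc_pairing_sum reverse_weight s1 * nc_pairing_sum reverse_weight s2))); last first.
  by move=> s _ _; rewrite nc_pairing_sum_cons.
rewrite walk_sum_split; apply: eq_split_sum => u1 b u2 uE.
move: um; rewrite uE /= size_cat /= => um.
have inner (p q : 'I_N) : walk_sum u1 y p (fun s1 => walk_sum u2 q z (fun s2 =>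
    reverse_weight (a, x, y) (b, p, q) * nc_pairing_sum reverse_weight s1 *
    nc_pairing_sum reverse_weight s2)) =
    reverse_weight (a, x, y) (b, p, q) *
      ((y == p)%:R * nc_pairing_sum c u1 * ((q == z)%:R * nc_pairing_sum c u2)).
  have lt1 : (size u1 < m)%N by lia.
  have lt2 : (size u2 < m)%N by lia.
  rewrite -(IH u1 y p lt1) -(IH u2 q z lt2).
  set A := walk_sum u1 y p (nc_pairing_sum _).
  set B := walk_sum u2 q z (nc_pairing_sum _).
  rewrite [RHS](_ : _ = (reverse_weight (a, x, y) (b, p, q) * B) * A); last by ring.
  rewrite -walk_sumZ; apply: eq_walk_sum => s _ _.
  by rewrite walk_sumZ /B; ring.
under eq_bigr do under eq_bigr do rewrite inner.
rewrite (bigD1 y) //= [X in _ + X]big1 ?addr0; last first.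
  by move=> p py; rewrite big1 // => q _; rewrite [y == p]eq_sym (negPf py) mulr0n !mul0r mulr0.
rewrite (bigD1 x) //= [X in _ + X]big1 ?addr0; last first.
  by move=> q qx; rewrite /reverse_weight /= [x == q]eq_sym (negPf qx) andbF mul0r.
rewrite /reverse_weight /= !eqxx /=; ring.
Qed.

End WalkSums.

(** * Closed walks with many vertices *)

Section TreeWalks.
Variables (K : comNzRingType) (c : L -> L -> K) (k : K) (E : seq step -> K).
Hypothesis E_nil : E [::] = 1.
Hypothesis E_leaf : forall p q a b x y v,
  all (fun t : step => (t.1.2 != v) && (t.2 != v)) (p ++ q) -> x != v -> y != v ->
  E (p ++ (a, x, v) :: (b, v, y) :: q) =
    if x == y then k * c a b * E (p ++ q) else 0.

Let sum_count (A : {set 'I_N}) (s : seq 'I_N) : all (fun x => x \in A) s ->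
  (\sum_(v in A) count_mem v s = size s)%N.
Proof.
elim: s => [|y s IH] /=; first by rewrite big1.
move=> /andP[yA /IH sA]; rewrite big_split /= sA (bigD1 y) //= eqxx big1 //.
by move=> v /andP[_ vy]; rewrite eq_sym (negPf vy).
Qed.

(* Otherwise each vertex but the root is the target of at least two steps, and
   counting the steps by their targets bounds the number of vertices. *)
Lemma closed_walk_leaf x0 s : is_walk x0 x0 s ->
  (0 < size s)%N -> (size s + 2 <= 2 * #|x0 |: [set y in targets s]|)%N ->
  exists2 v, v != x0 & count_mem v (targets s) = 1.
Proof.
move=> wk s0; set A := x0 |: _ => sA.
have [/existsP[v /andP[vx /eqP v1]]|no] :=
  boolP [exists v, (v != x0) && (count_mem v (targets s) == 1)]; first by exists v.
have allA : all (fun x => x \in A) (targets s).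
  by apply/allP => y ys; rewrite !inE ys orbT.
have := sum_count allA; rewrite size_map (bigD1 x0) ?setU11 //=.
have c0 : (0 < count_mem x0 (targets s))%N.
  rewrite -has_count has_pred1 -{1}(is_walk_last wk).
  by case: s s0 {wk A sA no allA} => //= t s _; exact: mem_last.
have c2 v : v \in A -> v != x0 -> (2 <= count_mem v (targets s))%N.
  rewrite !inE => /predU1P[->|vs vx]; first by rewrite eqxx.
  have : (0 < count_mem v (targets s))%N by rewrite -has_count has_pred1.
  move: no; rewrite negb_exists => /forallP/(_ v); rewrite vx /=.
  by case: (count_mem v _) => [|[|n]].
have : (\sum_(v in A | v != x0) 2 <= \sum_(v in A | v != x0) count_mem v (targets s))%N.
  by apply: leq_sum => v /andP[vA vx]; exact: c2.
rewrite sum_nat_const.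
have -> : #|[pred v in A | v != x0]| = #|A :\ x0|.
  by apply: eq_card => v; rewrite !inE andbC.
(* The count gives [size s >= 1 + 2 * (#|A| - 1)], against [sA]. *)
have := cardsD1 x0 A; rewrite setU11 /= => H1 H2 H3; exfalso.
move: sA c0 H1 H2 H3.
move: (count_mem x0 _) (\sum_(v in A | _) _)%N #|A| #|_| (size s) => q1 q2 q3 q4 q5; lia.
Qed.

(** Induction on the length: at a vertex [v] visited once the steps into and out of [v] are
    consecutive, and [E_leaf] and [nc_pairing_sum_delete] erase them from both sides alike. If they
    do not traverse the same edge, both sides vanish. *)
Lemma tree_walk_eq x0 s : is_walk x0 x0 s ->
  (size s + 2 <= 2 * #|x0 |: [set y in targets s]|)%N ->
  E s = nc_pairing_sum (reverse_weight c k) s.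
Proof.
have [m] := ubnP (size s); elim: m s => // m IH s sm wk sA.
have [/size0nil ->|s0] := posnP (size s); first by rewrite E_nil nc_pairing_sum_nil.
have [v vx0 v1] := closed_walk_leaf wk s0 sA.
have vs : v \in targets s by rewrite -has_pred1 has_count v1.
have [p [t [r [sE tv vp]]]] : exists p t r, [/\ s = p ++ t :: r, t.2 = v & v \notin targets p].
  elim: s vs {sm wk sA s0 v1} => //= t s IHs; rewrite inE.
  case: (eqVneq v t.2) => [-> _|vt /= /IHs[p [t' [r [-> tv vp]]]]].
    by exists [::], t, s.
  by exists (t :: p), t', r; rewrite /= inE negb_or vt.
have vr : v \notin targets r.
  move: v1; rewrite sE /targets map_cat count_cat /= tv eqxx -has_pred1 has_count.
  by case: (count _ [seq _ | t <- r]) => // k'; rewrite !addnS.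
case: t tv sE => [[a x] v'] /= -> sE.
move: wk; rewrite sE is_walk_cat => /andP[wp /=]; set x' := last _ _.
rewrite -/(last x0 (targets p)) => /andP[/eqP xE wr].
(* [r] is not empty, since the walk ends at [x0] and not at [v]. *)
case: r vr sE wr => [|[[b v''] y] q] vr sE /= => [/eqP vx|/andP[/eqP vE wq]].
  by rewrite vx eqxx in vx0.
rewrite {v''}vE in vr sE *; move: vr; rewrite /= inE negb_or => /andP[vy vq].
have ap := is_walk_avoid wp vx0 vp; have aq := is_walk_avoid wq vy vq.
have xv : x != v.
  rewrite xE /x'; have := mem_last x0 (targets p); rewrite inE => /predU1P[->|xp].
    by rewrite eq_sym.
  by apply: contraNneq vp => <-.
have apq : all (fun t : step => (t.1.2 != v) && (t.2 != v)) (p ++ q) by rewrite all_cat ap.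
rewrite E_leaf // 1?eq_sym //.
rewrite (@nc_pairing_sum_delete _ _ _ (fun t : step => (t.1.2 != v) && (t.2 != v))) //; last first.
  move=> [[d x1] y1] /= /andP[n1 n2].
  rewrite /reverse_weight /= (negPf n1) (negPf n2) !andbF /=.
  by rewrite [v == _]eq_sym (negPf n1).
rewrite {1}/reverse_weight /= eqxx /=; case: (eqVneq x y) => [xy|]; last by rewrite mul0r.
congr (_ * _); apply: IH; first by move: sm; rewrite sE !size_cat /= !addnS => /ltnW.
  by rewrite is_walk_cat -/x' wp -xE xy.
(* Two steps are erased but only the vertex [v] disappears, so the bound on the number of vertices
   persists. *)
have : (#|(x0 |: [set y in targets s]) :\ v| <= #|x0 |: [set y in targets (p ++ q)]|)%N.
  apply: subset_leq_card; apply/subsetP => z; rewrite !inE sE /targets !map_cat /= !mem_cat !inE.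
  case: (eqVneq z v) => //= zv; rewrite -xy xE /x'.
  case/or4P => [->//|->|/eqP->|->]; rewrite ?orbT //.
  by have := mem_last x0 (targets p); rewrite inE => /orP[->//|->]; rewrite orbT.
have := cardsD1 v (x0 |: [set y in targets s]); rewrite !inE vs orbT.
move: sA; rewrite sE !size_cat /=; clear; lia.
Qed.

End TreeWalks.

(** * Counting walks with few vertices *)

Section Counting.
Variable K : numDomainType.

Lemma ler_norm_walk_sum u x z (F G : seq step -> K) :
  (forall s, labels s = u -> is_walk x z s -> `|F s| <= G s) ->
  `|walk_sum u x z F| <= walk_sum u x z G.
Proof.
elim: u x F G => [|a u IH] x F G FG /=.
  by case: eqP => [xz|_]; [apply: FG => //=; apply/eqP | rewrite normr0].
apply: le_trans (ler_norm_sum _ _ _) _; apply: ler_sum => y _.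
by apply: IH => s su wk; apply: FG; rewrite /= ?su ?eqxx.
Qed.

Lemma walk_sum_ge0 u x z (F : seq step -> K) : (forall s, 0 <= F s) -> 0 <= walk_sum u x z F.
Proof.
elim: u x F => [|a u IH] x F F0 /=; first by case: eqP.
by apply: sumr_ge0 => y _; apply: IH.
Qed.

(** [A] holds the vertices seen so far. A step goes back to [A], with at most [m] choices, or to one
    of at most [N] new vertices, which can happen at most [m - #|A|] times; hence a factor [m.+1]
    per step and a factor [N] per new vertex. *)
Lemma count_walks (A : {set 'I_N}) m u x : (#|A| <= m)%N ->
  \sum_z walk_sum u x z (fun s => (#|A :|: [set y in targets s]| <= m)%:R) <=
    (m.+1 ^ size u * N ^ (m - #|A|))%:R :> K.
Proof.
have N0 : (0 < N)%N by case: N x => // -[].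
elim: u A x => [|a u IH] A x Am /=.
  rewrite (bigD1 x) //= eqxx big1 ?addr0; last by move=> z; rewrite eq_sym => /negPf ->.
  by rewrite mul1n ler_nat (leq_trans (leq_b1 _)) // expn_gt0 N0.
rewrite exchange_big /=.
have setE y s : A :|: [set z in y :: targets s] = (y |: A) :|: [set z in targets s].
  by apply/setP => z; rewrite !inE orbCA orbA.
rewrite (bigID (mem A)) /=.
apply: (@le_trans _ _ (\sum_(y in A) (m.+1 ^ size u * N ^ (m - #|A|))%:R +
    \sum_(y < N | y \notin A) (m.+1 ^ size u * N ^ (m - #|A|).-1)%:R *+ (#|A| < m)%N)).
  apply: lerD; apply: ler_sum => y yA.
    have yAE : y |: A = A by apply/setUidPr; rewrite sub1set.
    apply: le_trans (IH A y Am); rewrite le_eqVlt; apply/predU1P; left.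
    by apply: eq_bigr => z _; apply: eq_walk_sum => s _ _; rewrite /= setE yAE.
  have cA : #|y |: A| = #|A|.+1 by rewrite cardsU1 yA.
  have [lt|ge] := ltnP #|A| m.
    rewrite mulr1n; have := IH (y |: A) y; rewrite cA subnS => /(_ lt).
    apply: le_trans; rewrite le_eqVlt; apply/predU1P; left.
    by apply: eq_bigr => z _; apply: eq_walk_sum => s _ _; rewrite setE.
  rewrite mulr0n big1 // => z _; rewrite -[RHS](walk_sum0 K u y z).
  apply: eq_walk_sum => s _ _; rewrite setE leqNgt.
  by rewrite (leq_trans _ (subset_leq_card (subsetUl _ _))) // cA ltnS.
rewrite !sumr_const -!mulrnA -natrD ler_nat.
set B := (m.+1 ^ size u)%N; rewrite expnS -/B.
have le1 : (B * N ^ (m - #|A|) * #|A| <= m * (B * N ^ (m - #|A|)))%N.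
  by rewrite mulnC leq_mul2r Am orbT.
have cN : (#|[pred y : 'I_N | y \notin A]| <= N)%N by rewrite -[X in (_ <= X)%N]card_ord max_card.
have le2 : (B * N ^ (m - #|A|).-1 * ((#|A| < m)%N * #|[pred y : 'I_N | y \notin A]|) <=
    B * N ^ (m - #|A|))%N.
  case: (ltnP #|A| m) => [lt|_]; last by rewrite mul0n muln0.
  rewrite mul1n -mulnA leq_mul2l; apply/orP; right.
  have -> : (m - #|A| = (m - #|A|).-1.+1)%N by lia.
  by rewrite expnS /= mulnC leq_mul2r cN orbT.
rewrite -[X in (_ <= X)%N]mulnA mulSn [X in (_ <= X)%N]addnC; exact: leq_add.
Qed.

End Counting.
End Walks.

From mathcomp Require Import generic_quotient ring_quotient.
From mathcomp Require Import all_classical all_reals all_analysis.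
From mathcomp Require Import measurable_realfun.
Import numFieldNormedType.Exports.
Import HBSimple HBNNSimple.

Local Open Scope classical_set_scope.
Local Open Scope quotient_scope.
Local Open Scope ring_scope.

(** * Independence *)

Section RealIndependence.
Context (d : measure_display) (T : measurableType d) (R : realType).
Variable P : probability T R.
Variables (G : set (set T)) (GM : <<s G>> `<=` @measurable d T).
Variables (g : T -> R) (k : R).
Hypothesis ig : P.-integrable setT (EFin \o g).
Hypothesis gk : forall A, <<s G>> A ->
  \int[P]_x (\1_A x * g x) = k * \int[P]_x \1_A x.

Let measurable_sub (h : T -> R) :
  measurable_fun setT (h : g_sigma_algebraType G -> R) -> measurable_fun setT h.
Proof. by move=> mh _ B mB; apply: GM; exact: mh. Qed.

Let integrable_indicM A : <<s G>> A ->
  P.-integrable setT (EFin \o (fun x => \1_A x * g x)).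
Proof.
move=> GA; apply: (le_integrable measurableT _ _ ig) => //=.
  apply/measurable_EFinP/measurable_funM; first exact/measurable_indic/GM.
  by apply/measurable_EFinP; exact: measurable_int ig.
move=> x _; rewrite lee_fin normrM indicE; case: (_ \in _).
  by rewrite normr1 mul1r.
by rewrite normr0 mul0r.
Qed.

Let Rintegral_simple (h : {nnsfun (g_sigma_algebraType G) >-> R}) :
  \int[P]_x (h x * g x) = k * \int[P]_x h x.
Proof.
pose s := finmap.enum_fset (fset_set (range h)).
pose A i := h @^-1` [set s`_i].
have GA i : <<s G>> (A i).
  have := @measurable_funP _ _ _ _ _ h measurableT [set s`_i] (measurable_set1 _).
  by rewrite setTI.
have hE x : h x = \sum_(i < size s) s`_i * \1_(A i) x by exact: fimfunEord.
have sumE (F : T -> R) (iF : forall i : 'I_(size s),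
      P.-integrable setT (EFin \o (fun x => \1_(A i) x * F x))) :
    \int[P]_x (h x * F x) = \sum_(i < size s) s`_i * \int[P]_x (\1_(A i) x * F x).
  under eq_Rintegral do rewrite hE mulr_suml.
  under eq_Rintegral do under eq_bigr do rewrite -mulrA.
  rewrite /Rintegral; under eq_integral do rewrite -sumEFin.
  have iF' (i : 'I_(size s)) : P.-integrable setT
      (fun x => (s`_i * (\1_(A i) x * F x))%:E).
    exact: (integrableZl measurableT _ (iF i)).
  rewrite integral_sum // -sum_fine.
    by apply: eq_bigr => i _; rewrite -[LHS]/(Rintegral _ _ _) RintegralZl.
  by move=> i _; apply: integrable_fin_num.
rewrite sumE; last by move=> i; exact: integrable_indicM.
under [X in _ = _ * X]eq_Rintegral do rewrite -[h _]mulr1.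
rewrite (sumE (cst 1)).
  rewrite mulr_sumr; apply: eq_bigr => i _; rewrite gk //.
  by under [in RHS]eq_Rintegral do rewrite mulr1; rewrite mulrCA.
move=> i; rewrite (_ : EFin \o _ = EFin \o (\1_(A i) : T -> R)).
  by apply: integrable_indic => //; exact: GM.
by apply/funext => x; rewrite /= mulr1.
Qed.

(** [f] is a pointwise limit of simple functions below it that are measurable for the sigma-algebra
    generated by [G]; dominated convergence carries the identity over from [Rintegral_simple]. *)
Lemma Rintegral_indep_ge0 (f : T -> R) :
  measurable_fun setT (f : g_sigma_algebraType G -> R) -> (forall x, 0 <= f x) ->
  P.-integrable setT (EFin \o f) -> P.-integrable setT (EFin \o (fun x => f x * g x)) ->
  \int[P]_x (f x * g x) = k * \int[P]_x f x.
Proof.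
move=> mf f0 iF ifg.
have mEf : measurable_fun setT (EFin \o f : g_sigma_algebraType G -> \bar R).
  exact/measurable_EFinP.
pose h n := nnsfun_approx (@measurableT _ (g_sigma_algebraType G)) mEf n.
have f0E x : setT x -> (0 <= (EFin \o f : g_sigma_algebraType G -> \bar R) x)%E.
  by rewrite lee_fin.
have hf n x : 0 <= h n x <= f x.
  rewrite fun_ge0 /= -lee_fin /h nnsfun_approxE.
  exact: (le_approx n f0E).
have hcvg x : h n x @[n --> \oo] --> f x.
  apply: (@fine_cvg _ _ \oo _ (EFin \o h ^~ x)).
  exact: (@cvg_nnsfun_approx _ _ _ _ (@measurableT _ (g_sigma_algebraType G)) _ mEf f0E x Logic.I).
(* Applied with [F = g] for the left side and with [F = cst 1] for the right. *)
have cvgF (F : T -> R) : measurable_fun setT F ->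
    P.-integrable setT (EFin \o (fun x => f x * F x)) ->
    \int[P]_x (h n x * F x) @[n --> \oo] --> \int[P]_x (f x * F x).
  move=> mF ifF.
  have mh n : measurable_fun setT (h n : T -> R).
    by apply: measurable_sub; exact: measurable_funP.
  have [|||||_ _ H] := @dominated_convergence _ _ _ P setT measurableT
     (fun n => EFin \o (fun x => h n x * F x)) (EFin \o (fun x => f x * F x))
     (fun x => `|(f x * F x)%:E|%E).
  - by move=> n; apply/measurable_EFinP; exact: measurable_funM.
  - exact: measurable_int ifF.
  - apply: aeW => x _ /=; apply: cvg_EFin; first exact: nearW.
    by apply: cvgMr_tmp; exact: hcvg.
  - exact: integrable_abse.
  - apply: aeW => x /= n _; rewrite lee_fin !normrM ler_wpM2r //.
    by have /andP[h0 hfx] := hf n x; rewrite !ger0_norm.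
  apply: fine_cvg; rewrite fineK; last exact: integrable_fin_num.
  exact: H.
have mg : measurable_fun setT g.
  by apply/measurable_EFinP; exact: measurable_int ig.
have i1 : P.-integrable setT (EFin \o (fun x => f x * cst 1 x)).
  rewrite (_ : EFin \o _ = EFin \o f) //.
  by apply/funext => x; rewrite /= mulr1.
have cg := cvgF _ mg ifg; have c1 := cvgF (cst 1) (measurable_cst _) i1.
have {}c1 : k * \int[P]_x (h n x * cst 1 x) @[n --> \oo] -->
    k * \int[P]_x (f x * cst 1 x) by exact: cvgMl_tmp.
have E n : \int[P]_x (h n x * g x) = k * \int[P]_x (h n x * cst 1 x).
  by rewrite Rintegral_simple; under [in RHS]eq_Rintegral do rewrite mulr1.
have {}cg : k * \int[P]_x (h n x * cst 1 x) @[n --> \oo] --> \int[P]_x (f x * g x).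
  by under eq_fun do rewrite -E.
rewrite (cvg_unique (@Rhausdorff R) cg c1); congr (_ * _).
by under eq_Rintegral do rewrite mulr1.
Qed.

End RealIndependence.

Section ComplexIndependence.
Context (d : measure_display) (T : measurableType d) (R : realType).
Variable P : probability T R.
Local Notation C := R[i].

(** The positive and negative parts of [f] reduce the claim to the non-negative case; both are
    dominated by the modulus of [f], which gives the integrability. *)
Lemma Rintegral_indep (G : set (set T)) (GM : <<s G>> `<=` @measurable d T)
    (f g : T -> R) (k : R) :
  P.-integrable setT (EFin \o g) ->
  (forall A, <<s G>> A -> \int[P]_x (\1_A x * g x) = k * \int[P]_x \1_A x) ->
  measurable_fun setT (f : g_sigma_algebraType G -> R) ->
  P.-integrable setT (EFin \o f) ->
  P.-integrable setT (EFin \o (fun x => f x * g x)) ->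
  \int[P]_x (f x * g x) = k * \int[P]_x f x.
Proof.
move=> ig gk mf iF ifg.
have mT h : measurable_fun setT (h : g_sigma_algebraType G -> R) ->
    measurable_fun [set: T] h.
  by move=> mh _ B mB; apply: GM; exact: mh.
have mg : measurable_fun setT g.
  by apply/measurable_EFinP; exact: measurable_int ig.
pose fp x := Num.max (f x) 0; pose fm x := Num.max (- f x) 0.
have mp : measurable_fun setT (fp : g_sigma_algebraType G -> R).
  by apply: measurable_maxr => //; exact: measurable_cst.
have mm : measurable_fun setT (fm : g_sigma_algebraType G -> R).
  by apply: measurable_maxr; [exact: measurable_funN | exact: measurable_cst].
have p0 x : 0 <= fp x by rewrite le_max lexx orbT.
have m0 x : 0 <= fm x by rewrite le_max lexx orbT.
have pf x : fp x <= `|f x| by rewrite ge_max ler_norm /=.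
have mf' x : fm x <= `|f x| by rewrite ge_max normr_ge0 -normrN ler_norm.
have dom (h : T -> R) : measurable_fun [set: T] h -> (forall x, 0 <= h x) ->
    (forall x, h x <= `|f x|) -> P.-integrable setT (EFin \o h) /\
    P.-integrable setT (EFin \o (fun x => h x * g x)).
  move=> mh h0 hf; split.
    apply: (le_integrable measurableT _ _ iF); first exact/measurable_EFinP.
    by move=> x _; rewrite lee_fin ger0_norm.
  apply: (le_integrable measurableT _ _ ifg).
    by apply/measurable_EFinP; exact: measurable_funM.
  by move=> x _; rewrite lee_fin !normrM ler_wpM2r // ger0_norm.
have [ip ipg] := dom _ (mT _ mp) p0 pf.
have [im img] := dom _ (mT _ mm) m0 mf'.
have fE x : f x = fp x - fm x.
  by rewrite /fp /fm /Order.max; case: (ltP (f x) 0); case: (ltP (- f x) 0); lra.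
under eq_Rintegral do rewrite fE mulrBl.
under [in RHS]eq_Rintegral do rewrite fE.
by rewrite !RintegralB // !(Rintegral_indep_ge0 GM ig gk) // mulrBr.
Qed.

(** The expectation on functions: measurability for a sub-sigma-algebra is a property of a function,
    not of its class modulo null sets. *)
Definition mean (f : linfminus P) : C := expectL (\pi_(Linfminus P) f).

Lemma integrable_linfminus (f : linfminus P) (h : T -> R) :
  measurable_fun setT h -> (forall x, `|h x| <= normc (f x)) ->
  P.-integrable setT (EFin \o h).
Proof.
case: f => f /= /asboolP[fr fi fL] mh hf.
have /Lfun1_integrable i1 := fL 1 (lexx _).
apply: (le_integrable measurableT _ _ i1); first exact/measurable_EFinP.
by move=> x _; rewrite lee_fin (le_trans (hf x)) // ler_norm.
Qed.

Lemma normr_Re_le (z : C) : `|complex.Re z| <= normc z.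
Proof. by case: z => a b /=; rewrite -sqrtr_sqr ler_wsqrtr // lerDl sqr_ge0. Qed.

Lemma normr_Im_le (z : C) : `|complex.Im z| <= normc z.
Proof. by case: z => a b /=; rewrite -sqrtr_sqr ler_wsqrtr // lerDr sqr_ge0. Qed.

Lemma measurable_Re_linfminus (f : linfminus P) :
  measurable_fun setT (fun x => complex.Re (f x)).
Proof. by case: f => f /= /asboolP[]. Qed.

Lemma measurable_Im_linfminus (f : linfminus P) :
  measurable_fun setT (fun x => complex.Im (f x)).
Proof. by case: f => f /= /asboolP[]. Qed.

Hint Resolve measurable_Re_linfminus measurable_Im_linfminus : core.

Lemma integrable_Re (f : linfminus P) :
  P.-integrable setT (EFin \o (fun x => complex.Re (f x))).
Proof. by apply: (@integrable_linfminus f) => // x; exact: normr_Re_le. Qed.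

Lemma integrable_Im (f : linfminus P) :
  P.-integrable setT (EFin \o (fun x => complex.Im (f x))).
Proof. by apply: (@integrable_linfminus f) => // x; exact: normr_Im_le. Qed.

Lemma linfminusM (f g : linfminus P) x : (f * g) x = f x * g x.
Proof. by []. Qed.

Lemma meanD (f g : linfminus P) : mean (f + g) = mean f + mean g.
Proof.
rewrite /mean !expectL_pi; apply/eqP; rewrite eq_complex; apply/andP; split => /=.
  rewrite -RintegralD //; [|exact: integrable_Re..].
  by apply/eqP/eq_Rintegral => x _; exact: raddfD.
rewrite -RintegralD //; [|exact: integrable_Im..].
by apply/eqP/eq_Rintegral => x _; exact: raddfD.
Qed.

Lemma indic_Linfminus_subproof (A : set T) : measurable A ->
  (fun x => (\1_A x)%:C%C) \in @Linfminus_pred _ T R P.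
Proof.
move=> mA; have mI : measurable_fun setT (\1_A : T -> R).
  exact: measurable_indic.
apply/asboolP; split; [exact: mI | exact: measurable_cst |].
move=> p p1; apply: (@Lfun_dom _ _ _ P _ (cst 1)) => //.
- by move=> x; rewrite normc_ge0 /= expr0n addr0 sqrtr_sqr indicE;
     case: (_ \in _); rewrite ?normr1 ?normr0.
- exact: measurable_normc.
- exact: Lfun_cst.
Qed.

Definition indL (A : set T) (mA : measurable A) : linfminus P :=
  MkLinfminus (indic_Linfminus_subproof mA).

Lemma mean_indL (A : set T) (mA : measurable A) :
  mean (indL mA) = (fine (P A))%:C%C.
Proof.
rewrite /mean expectL_pi /= Rintegral_cst // mul0r; congr (_ +i* _)%C.
by rewrite /Rintegral integral_indic // setIT.
Qed.

(** The real and imaginary parts of [f * g] are combinations of four products of real functions, to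
    each of which [Rintegral_indep] applies. *)
Lemma mean_indep (G : set (set T)) (GM : <<s G>> `<=` @measurable d T)
    (f g : linfminus P) (k : C) :
  measurable_fun setT ((fun x => complex.Re (f x)) : g_sigma_algebraType G -> R) ->
  measurable_fun setT ((fun x => complex.Im (f x)) : g_sigma_algebraType G -> R) ->
  (forall A (mA : measurable A), <<s G>> A ->
    mean (indL mA * g) = k * (fine (P A))%:C%C) ->
  mean (f * g) = k * mean f.
Proof.
move=> mfr mfi gk.
have gRI A : <<s G>> A ->
    \int[P]_x (\1_A x * complex.Re (g x)) = complex.Re k * \int[P]_x \1_A x /\
    \int[P]_x (\1_A x * complex.Im (g x)) = complex.Im k * \int[P]_x \1_A x.
  move=> GA; have mA := GM _ GA; have := gk _ mA GA.
  have -> : \int[P]_x \1_A x = fine (P A).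
    by rewrite /Rintegral integral_indic // setIT.
  rewrite /mean expectL_pi; case: k {gk} => kr ki /= [].
  rewrite !mulr0 subr0 add0r => <- <-; split; apply: eq_Rintegral => x _.
    rewrite -[X in _ = complex.Re X]/((\1_A x)%:C%C * g x).
    by case: (g x) => a b /=; rewrite mul0r subr0.
  rewrite -[X in _ = complex.Im X]/((\1_A x)%:C%C * g x).
  by case: (g x) => a b /=; rewrite mul0r addr0.
have iM (u v : T -> R) : measurable_fun setT u -> measurable_fun setT v ->
    (forall x, `|u x| <= normc (f x)) -> (forall x, `|v x| <= normc (g x)) ->
    P.-integrable setT (EFin \o (fun x => u x * v x)).
  move=> mu mv uf vg; apply: (@integrable_linfminus (f * g)).
    exact: measurable_funM.
  by move=> x; rewrite linfminusM Normc.normcM normrM ler_pM.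
have indR u : measurable_fun setT (u : g_sigma_algebraType G -> R) ->
    (forall x, `|u x| <= normc (f x)) ->
    \int[P]_x (u x * complex.Re (g x)) = complex.Re k * \int[P]_x u x /\
    \int[P]_x (u x * complex.Im (g x)) = complex.Im k * \int[P]_x u x.
  move=> mu uf; have mu' : measurable_fun [set: T] u.
    by move=> _ B mB; apply: GM; exact: mu.
  have iu : P.-integrable setT (EFin \o u) by exact: integrable_linfminus uf.
  split; apply: (Rintegral_indep GM) => //.
  - exact: integrable_Re.
  - by move=> A /gRI[].
  - by apply: iM => // x; exact: normr_Re_le.
  - exact: integrable_Im.
  - by move=> A /gRI[].
  - by apply: iM => // x; exact: normr_Im_le.
have [rr ri] := indR _ mfr (fun x => normr_Re_le (f x)).
have [ir ii] := indR _ mfi (fun x => normr_Im_le (f x)).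
rewrite /mean !expectL_pi; apply/eqP; rewrite eq_complex.
have -> : \int[P]_x complex.Re ((f * g) x) =
    \int[P]_x (complex.Re (f x) * complex.Re (g x) - complex.Im (f x) * complex.Im (g x)).
  by apply: eq_Rintegral => x _; rewrite linfminusM; case: (f x); case: (g x).
have -> : \int[P]_x complex.Im ((f * g) x) =
    \int[P]_x (complex.Re (f x) * complex.Im (g x) + complex.Im (f x) * complex.Re (g x)).
  by apply: eq_Rintegral => x _; rewrite linfminusM; case: (f x); case: (g x).
rewrite RintegralB ?RintegralD ?rr ?ri ?ir ?ii //;
  do ?[by apply: iM => // x; rewrite ?normr_Re_le ?normr_Im_le].
by case: k {gk gRI indR rr ri ir ii} => kr ki /=; apply/andP; split; apply/eqP; ring.
Qed.

Lemma sigma_rv_measurable (F : set (Linfminus P)) :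
  sigma_rv F `<=` @measurable d T.
Proof.
apply: smallest_sub; first exact: sigma_algebra_measurable.
move=> A [f Ff [B mB ->]]; rewrite -[X in measurable X]setTI.
have m2 : measurable_fun setT
    (fun x => (complex.Re (repr f x), complex.Im (repr f x))).
  by apply/measurable_fun_pair.
exact: m2.
Qed.

Definition sigma_rv_gen (F : set (Linfminus P)) :=
  [set A | exists2 f, F f & exists2 B : set (R * R), measurable B &
     A = (fun x => (complex.Re (repr f x), complex.Im (repr f x))) @^-1` B].

Definition adapted (F : set (Linfminus P)) : {pred linfminus P} := fun f =>
  `[< measurable_fun setT ((fun x => complex.Re (f x)) :
        g_sigma_algebraType (sigma_rv_gen F) -> R) /\
      measurable_fun setT ((fun x => complex.Im (f x)) :
        g_sigma_algebraType (sigma_rv_gen F) -> R) >].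

Section Factorization.
Variables (K : eqType) (D : pred K) (F : K -> set (Linfminus P)).
Hypothesis indepF : independent_sets D F.

Let bigcap_cons (e : K) (s : seq K) (A : K -> set T) :
  \bigcap_(k in [set` e :: s]) A k = A e `&` \bigcap_(k in [set` s]) A k.
Proof.
apply/seteqP; split => x /= H.
  by split => [|k ks]; apply: H; rewrite /= inE ?eqxx ?(ks : k \in s) ?orbT.
by move=> k; rewrite /= inE => /predU1P[->|ks]; [exact: H.1 | exact: H.2].
Qed.

(* Starting from events only, the sigma-algebras are treated one at a time, an
   arbitrary event being replaced by an adapted variable. *)
Let mean_prod_indL (es s : seq K) (f : K -> linfminus P) (A : K -> set T)
    (mA : measurable (\bigcap_(k in [set` s]) A k)) :
  uniq (es ++ s) -> {in es ++ s, forall k, D k} ->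
  {in es, forall k, f k \in adapted (F k)} ->
  {in s, forall k, sigma_rv (F k) (A k)} ->
  mean ((\prod_(k <- es) f k) * indL mA) =
    \prod_(k <- es) mean (f k) * (fine (P (\bigcap_(k in [set` s]) A k)))%:C%C.
Proof.
elim: es s A mA => [|e es IH] s A mA us Ds fF sA.
  by rewrite !big_nil !mul1r mean_indL.
have [e_es us'] : e \notin es ++ s /\ uniq (es ++ s) by move: us => /= /andP[].
have De : D e by apply: Ds; rewrite inE eqxx.
rewrite !big_cons -[X in mean X]mulrA -[RHS]mulrA [RHS]mulrC.
have /asboolP[fr fi] : f e \in adapted (F e) by apply: fF; rewrite inE eqxx.
apply: (mean_indep (@sigma_rv_measurable (F e))) => // B mB FB.
(* The event [B] joins the others as the event of index [e], so that the induction hypothesis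
   applies to [e :: s]. *)
pose A' k := if k == e then B else A k.
have A'E k : k \in es ++ s -> A' k = A k.
  by rewrite /A'; case: eqP => // ->; rewrite (negPf e_es).
have capE : \bigcap_(k in [set` e :: s]) A' k = B `&` \bigcap_(k in [set` s]) A k.
  rewrite bigcap_cons {1}/A' eqxx; congr (_ `&` _); apply: eq_bigcapr => k ks.
  by rewrite A'E // mem_cat (ks : k \in s) orbT.
have mA' : measurable (\bigcap_(k in [set` e :: s]) A' k).
  by rewrite capE; exact: measurableI.
have perm : perm_eq (es ++ e :: s) (e :: es ++ s) by rewrite -(cat1s e s) perm_catCA.
have sA' : {in e :: s, forall k, sigma_rv (F k) (A' k)}.
  move=> k; rewrite inE => /predU1P[->|ks]; first by rewrite /A' eqxx.
  by rewrite A'E ?mem_cat ?ks ?orbT //; exact: sA.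
have := IH (e :: s) A' mA'.
rewrite (perm_uniq perm) /= e_es us' => /(_ isT) H.
have -> : indL mB * (\prod_(k <- es) f k * indL mA) = \prod_(k <- es) f k * indL mA'.
  rewrite mulrCA; congr (_ * _); apply/val_inj/funext => x /=.
  rewrite -[LHS]/((\1_B x)%:C%C * (\1_(\bigcap_(k in [set` s]) A k) x)%:C%C).
  by rewrite capE indicI /= -rmorphM.
rewrite H; first last.
- exact: sA'.
- by move=> k kes; apply: fF; rewrite inE kes orbT.
- by move=> k; rewrite (perm_mem perm) => /Ds.
have us2 : uniq s by move: us'; rewrite cat_uniq => /and3P[].
have es_s : e \notin s by move: e_es; rewrite mem_cat negb_or => /andP[].
(* What remains is that [B] is independent of the intersection over [s]: independence is used once
   for [e :: s] and once for [s]. *)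
rewrite -mulrA; congr (_ * _); rewrite -rmorphM; congr (_%:C%C).
rewrite indepF //; last 2 first.
- by rewrite /= es_s us2.
- by move=> k; rewrite inE => /predU1P[->//|ks]; apply: Ds; rewrite inE mem_cat ks !orbT.
rewrite big_cons {1}/A' eqxx [RHS]mulrC indepF //; last first.
  by move=> k ks; apply: Ds; rewrite inE mem_cat ks !orbT.
have -> : (\prod_(k <- s) P (A' k) = \prod_(k <- s) P (A k))%E.
  by apply: eq_big_seq => k ks; rewrite A'E // mem_cat ks orbT.
rewrite fineM //; first exact: fin_num_measure.
rewrite -indepF //; first exact: fin_num_measure.
by move=> k ks; apply: Ds; rewrite inE mem_cat ks !orbT.
Qed.

Lemma mean_prod_indep (es : seq K) (f : K -> linfminus P) :
  uniq es -> {in es, forall k, D k} ->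
  {in es, forall k, f k \in adapted (F k)} ->
  mean (\prod_(k <- es) f k) = \prod_(k <- es) mean (f k).
Proof.
move=> ues Des fF.
have E : \bigcap_(k in [set` [::] : seq K]) (fun=> setT) k = [set: T].
  by apply: bigcapT.
have mA : measurable (\bigcap_(k in [set` [::] : seq K]) (fun=> [set: T]) k).
  by rewrite E.
have ind1 : indL mA = 1 by apply/val_inj/funext => x /=; rewrite E indicT.
transitivity (mean (\prod_(k <- es) f k * indL mA)).
  by rewrite ind1 mulr1.
rewrite mean_prod_indL ?cats0 //.
by rewrite E probability_setT /= mulr1.
Qed.

End Factorization.
End ComplexIndependence.

(** * Expectations of products of entries along a walk *)

Section Steps.
Context (d : measure_display) (T : measurableType d) (R : realType).
Variable P : probability T R.
Local Notation C := R[i].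

Lemma adapted1 (F : set (Linfminus P)) : 1 \in adapted F.
Proof. by apply/asboolP; split; exact: measurable_cst. Qed.

Lemma adaptedM (F : set (Linfminus P)) (f g : linfminus P) :
  f \in adapted F -> g \in adapted F -> f * g \in adapted F.
Proof.
move=> /asboolP[fr fi] /asboolP[gr gi]; apply/asboolP; split.
  rewrite (_ : (fun x => _) = (fun x => complex.Re (f x) * complex.Re (g x) -
      complex.Im (f x) * complex.Im (g x))).
    by apply: measurable_funB; exact: measurable_funM.
  by apply/funext => x; rewrite linfminusM; case: (f x); case: (g x).
rewrite (_ : (fun x => _) = (fun x => complex.Re (f x) * complex.Im (g x) +
    complex.Im (f x) * complex.Re (g x))).
  by apply: measurable_funD; exact: measurable_funM.
by apply/funext => x; rewrite linfminusM; case: (f x); case: (g x).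
Qed.

(** The conjugate is included because an entry below the diagonal is the conjugate of the mirrored
    entry, and it is the latter that generates the sigma-algebra of the edge. *)
Lemma adapted_repr (F : set (Linfminus P)) f : F f ->
  repr f \in adapted F /\ MkLinfminus (conj_Linfminus (repr f)) \in adapted F.
Proof.
move=> Ff; set G := sigma_rv_gen F.
have mr : measurable_fun setT ((fun x => complex.Re (repr f x)) : g_sigma_algebraType G -> R).
  move=> _ B mB; rewrite setTI; apply: sub_sigma_algebra; exists f => //.
  exists (B `*` setT); first exact: measurableX.
  by apply/seteqP; split => x //= [].
have mi : measurable_fun setT ((fun x => complex.Im (repr f x)) : g_sigma_algebraType G -> R).
  move=> _ B mB; rewrite setTI; apply: sub_sigma_algebra; exists f => //.
  exists (setT `*` B); first exact: measurableX.
  by apply/seteqP; split => x //= [].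
split; apply/asboolP => //; split.
  by rewrite (_ : (fun x => _) = (fun x => complex.Re (repr f x))) //;
     apply/funext => x /=; case: (repr f x).
rewrite (_ : (fun x => _) = (fun x => - complex.Im (repr f x))).
  exact: measurable_funN.
by apply/funext => x /=; case: (repr f x).
Qed.

Variables (L : Type) (N : nat) (X : L -> 'M[Linfminus P]_N).
Hypothesis X_sa : forall k i j, X k j i = conjL (X k i j).
Hypothesis X_indep : independent_sets (fun p : 'I_N * 'I_N => (p.1 <= p.2)%N)
  (fun p => [set X k p.1 p.2 | k in setT]).

(** The undirected edge, coded with its endpoints in increasing order, as in the index set of the
    independent families. *)
Definition edge (t : L * 'I_N * 'I_N) : 'I_N * 'I_N :=
  if (t.1.2 <= t.2)%N then (t.1.2, t.2) else (t.2, t.1.2).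

Definition mean_steps (s : seq (L * 'I_N * 'I_N)) : C :=
  expectL (\prod_(t <- s) X t.1.1 t.1.2 t.2).

Lemma mean_steps_nil : mean_steps [::] = 1.
Proof.
rewrite /mean_steps big_nil -(rmorph1 (\pi_(Linfminus P))) expectL_pi /=.
have E (r : R) : \int[P]_x r = r.
  transitivity (r * fine (P setT)); first exact: Rintegral_cst.
  by rewrite probability_setT mulr1.
by rewrite !E.
Qed.

(** Below the diagonal the conjugate of the chosen representative of the mirrored entry is taken:
    another representative would agree with it only almost surely and might fail to be measurable
    for the sigma-algebra of the edge. *)
Let rep (t : L * 'I_N * 'I_N) : linfminus P :=
  if (t.1.2 <= t.2)%N then repr (X t.1.1 t.1.2 t.2)
  else MkLinfminus (conj_Linfminus (repr (X t.1.1 t.2 t.1.2))).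

Let repK t : \pi_(Linfminus P) (rep t) = X t.1.1 t.1.2 t.2.
Proof.
rewrite /rep; case: ifP => _; first by rewrite reprK.
by rewrite -conjL_pi reprK -X_sa.
Qed.

Let F (p : 'I_N * 'I_N) : set (Linfminus P) := [set X k p.1 p.2 | k in setT].

Let rep_adapted t : rep t \in adapted (F (edge t)).
Proof.
rewrite /rep /edge; case: ifP => _.
  by have [] // := @adapted_repr (F (t.1.2, t.2)) (X t.1.1 t.1.2 t.2); exists t.1.1.
by have [] // := @adapted_repr (F (t.2, t.1.2)) (X t.1.1 t.2 t.1.2); exists t.1.1.
Qed.

Let mean_steps_rep s : mean_steps s = mean (\prod_(t <- s) rep t).
Proof.
rewrite /mean_steps /mean rmorph_prod; congr (expectL _).
by apply: eq_bigr => t _; exact/esym/repK.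
Qed.

Lemma edge_le t : ((edge t).1 <= (edge t).2)%N.
Proof. by rewrite /edge; case: ifP => //= /negbT; rewrite -ltnNge => /ltnW. Qed.

Let mean_steps_edges s (es : seq ('I_N * 'I_N)) :
  uniq es -> all (fun e : 'I_N * 'I_N => e.1 <= e.2)%N es -> all (fun t => edge t \in es) s ->
  mean_steps s = \prod_(e <- es) mean_steps [seq t <- s | edge t == e].
Proof.
move=> ues les ses; rewrite mean_steps_rep.
have -> : \prod_(t <- s) rep t =
    \prod_(e <- es) \prod_(t <- s | edge t == e) rep t.
  rewrite (exchange_big_dep predT) //=.
  elim: s ses => [|t s IH] /=; first by rewrite !big_nil.
  move=> /andP[tes /IH ss]; rewrite !big_cons -ss; congr (_ * _).
  rewrite -big_filter (eq_filter (a2 := pred1 (edge t))) => [|e /=].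
    by rewrite filter_pred1_uniq // big_seq1.
  by rewrite eq_sym.
rewrite (mean_prod_indep X_indep) //.
- by apply: eq_bigr => e _; rewrite mean_steps_rep big_filter.
- by move=> e ees; move/allP: les => /(_ _ ees).
- move=> e _; elim/big_ind: _ => [|f g|t /eqP <-].
  + exact: adapted1.
  + exact: adaptedM.
  + exact: rep_adapted.
Qed.

Lemma mean_steps_split (e : 'I_N * 'I_N) s : (e.1 <= e.2)%N ->
  mean_steps s = mean_steps [seq t <- s | edge t == e] *
                 mean_steps [seq t <- s | edge t != e].
Proof.
move=> le; pose es := undup (e :: map edge s).
have ues : uniq es by exact: undup_uniq.
have les : all (fun e : 'I_N * 'I_N => e.1 <= e.2)%N es.
  apply/allP => e'; rewrite mem_undup inE => /predU1P[->//|].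
  by elim: s {es ues} => //= t s IH; rewrite inE => /predU1P[->|//]; exact: edge_le.
have ses : all (fun t => edge t \in es) s.
  have : all (fun x => x \in es) (map edge s).
    by apply/allP => x xs; rewrite mem_undup inE xs orbT.
  by rewrite all_map.
have ses' : all (fun t => edge t \in es) [seq t <- s | edge t != e].
  by rewrite all_filter; apply: sub_all ses => t /= ->; rewrite implybT.
have ees : e \in es by rewrite mem_undup inE eqxx.
rewrite (mean_steps_edges ues les ses) (mean_steps_edges ues les ses').
rewrite !(bigD1_seq e) //= -filter_predI.
(* Among the steps off [e] none lies on [e], so their factor at [e] is the mean of the empty list,
   which is 1. *)
rewrite (@eq_filter _ (predI _ _) pred0); last by move=> t /=; case: eqP.
rewrite filter_pred0 mean_steps_nil mul1r; congr (_ * _).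
apply: eq_bigr => e' e'e; rewrite -filter_predI; congr mean_steps.
by apply: eq_filter => t /=; case: eqP => //= ->; rewrite e'e.
Qed.

End Steps.

(** * The bi-matrix model *)

Section MatrixModel.
Context (d : measure_display) (T : measurableType d) (R : realType).
Variable P : probability T R.
Local Notation C := R[i].

Lemma expectLD (f g : Linfminus P) : expectL (f + g) = expectL f + expectL g.
Proof.
rewrite -(reprK f) -(reprK g) -[X in expectL X]rmorphD.
exact: meanD.
Qed.

Lemma expectL0 : expectL (0 : Linfminus P) = 0.
Proof. by apply: (addrI (expectL (0 : Linfminus P))); rewrite -expectLD !addr0. Qed.

Lemma edge_eq (L : Type) (N : nat) (t t' : L * 'I_N * 'I_N) :
  (edge t == edge t') = ((t.1.2, t.2) \in [:: (t'.1.2, t'.2); (t'.2, t'.1.2)]).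
Proof.
case: t t' => [[a x] y] [[a' x'] y']; rewrite /edge /= !inE !xpair_eqE.
do 2?case: leqP => /= ?; rewrite xpair_eqE /=; apply/idP/idP;
  do ?[by move=> /andP[/eqP ? /eqP ?]; subst; rewrite !eqxx ?orbT];
  move=> /orP[] /andP[/eqP ? /eqP ?]; subst; rewrite ?eqxx //; try lia;
  by apply/andP; split; apply/eqP/val_inj => /=; lia.
Qed.

Section FixedSize.
Variables (I J : Type) (c : I + J -> I + J -> C) (N : nat).
Variable X : I + J -> 'M[Linfminus P]_N.
Hypothesis X_centered : forall k i j, expectL (X k i j) = 0.
Hypothesis X_sa : forall k i j, X k j i = conjL (X k i j).
Hypothesis X_indep : independent_sets (fun p : 'I_N * 'I_N => (p.1 <= p.2)%N)
  (fun p => [set X k p.1 p.2 | k in setT]).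
Hypothesis X_cov : forall k1 k2 i j,
  expectL (X k1 i j * X k2 j i) = N%:R^-1 * c k1 k2.

(** No other step touches [v], so at most these two traverse the edge between [x] and [v], and it
    splits off by independence. If [x = y] they give a covariance; otherwise the first one alone
    gives the expectation of a centered entry. *)
Lemma mean_steps_leaf p q a b x y v :
  all (fun t : (I + J) * 'I_N * 'I_N => (t.1.2 != v) && (t.2 != v)) (p ++ q) ->
  x != v -> y != v ->
  mean_steps X (p ++ (a, x, v) :: (b, v, y) :: q) =
    if x == y then N%:R^-1 * c a b * mean_steps X (p ++ q) else 0.
Proof.
rewrite all_cat => /andP[ap aq] xv yv.
set A := (a, x, v); set B := (b, v, y).
have no s : all (fun t : (I + J) * 'I_N * 'I_N => (t.1.2 != v) && (t.2 != v)) s ->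
    [seq t <- s | edge t == edge A] = [::] /\ [seq t <- s | edge t != edge A] = s.
  elim: s => //= t s IHs /andP[/andP[t1 t2] /IHs[E1 E2]].
  by rewrite edge_eq /= !inE !xpair_eqE (negPf t1) (negPf t2) !andbF /= E1 E2.
have [p1 p2] := no _ ap; have [q1 q2] := no _ aq.
rewrite (mean_steps_split X_sa X_indep _ (edge_le A)) !filter_cat /= p1 p2 q1 q2 eqxx /=.
have -> : (edge B == edge A) = (x == y).
  rewrite edge_eq /= !inE !xpair_eqE eqxx [v == x]eq_sym (negPf xv) /= eq_sym.
  by [].
case: eqP => [xy|_] /=.
  by rewrite {1}/mean_steps !big_cons big_nil mulr1 /= -xy X_cov.
rewrite {1}/mean_steps big_cons big_nil mulr1 /= X_centered.
by rewrite mul0r.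
Qed.

Lemma mean_steps_tree x0 s : is_walk x0 x0 s ->
  (size s + 2 <= 2 * #|finset.setU [set x0]%SET (finset (fun y => y \in targets s))|)%N ->
  mean_steps X s = nc_pairing_sum (reverse_weight c N%:R^-1) s.
Proof.
apply: tree_walk_eq; first exact: mean_steps_nil.
exact: mean_steps_leaf.
Qed.

(** A left operator multiplies by [X k] on the left and, the entries commuting, a right operator
    multiplies by it on the right. The first letter acts last, so a right one ends up rightmost, as
    in [left_right]. *)
Lemma two_faced_prod (w : seq (I + J)) :
  (foldr (fun k B => LXN_mul (two_faced X k) B) (LXN_one P N) w : XN P N -> XN P N) 1%:M =
  foldr (fun k M => X k *m M) 1%:M (left_right w).
Proof.
have foldr_mul (s : seq (I + J)) (M : 'M[Linfminus P]_N) :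
    foldr (fun k M => X k *m M) M s = foldr (fun k M => X k *m M) 1%:M s *m M.
  by elim: s => [|k s IHs] /=; rewrite ?mul1mx // IHs mulmxA.
elim: w => [|k w IH] //=.
transitivity (two_faced X k (foldr (fun k M => X k *m M) 1%:M (left_right w))).
  by rewrite -IH.
case: k => k; rewrite /left_right /=.
  by apply/matrixP => i j; rewrite !mxE.
rewrite rev_cons -cats1 catA; set u := (_ ++ rev [seq _ <- w | _]).
rewrite foldr_cat [RHS]foldr_mul /= mulmx1.
apply/matrixP => i j; rewrite !mxE; apply: eq_bigr => l _; exact: mulrC.
Qed.

Lemma expectL_walk_sum u (x z : 'I_N) (F : seq ((I + J) * 'I_N * 'I_N) -> Linfminus P) :
  expectL (walk_sum u x z F) = walk_sum u x z (fun s => expectL (F s)).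
Proof.
elim: u x F => [|a u IH] x F /=; first by case: eqP => // _; exact: expectL0.
rewrite (big_morph _ expectLD expectL0); apply: eq_bigr => y _; exact: IH.
Qed.

Lemma trace_two_faced n (chi : 'I_n -> I + J) :
  \tr (expectLXN (\big[@LXN_mul _ _ _ P N/LXN_one P N]_(k < n) two_faced X (chi k))) =
  \sum_x walk_sum (left_right [seq chi k | k <- enum 'I_n]) x x (mean_steps X).
Proof.
rewrite /mxtrace; apply: eq_bigr => x _; rewrite mxE.
have -> : \big[@LXN_mul _ _ _ P N/LXN_one P N]_(k < n) two_faced X (chi k) =
    foldr (fun k B => LXN_mul (two_faced X k) B) (LXN_one P N) [seq chi k | k <- enum 'I_n].
  have -> : index_enum 'I_n = enum 'I_n by rewrite enumT [index_enum _]unlock.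
  by rewrite unlock; elim: (enum 'I_n) => //= k s ->.
by rewrite two_faced_prod walk_sum_mulmx expectL_walk_sum.
Qed.

End FixedSize.
End MatrixModel.

(** * Bounds on the expectations along walks *)

Section Asymptotics.
Context (R : realType) (d : measure_display) (T : measurableType d).
Variable P : probability T R.
Local Notation C := R[i].
Variables (I J : Type) (c : I + J -> I + J -> C).
Variable X : forall N : nat, I + J -> 'M[Linfminus P]_N.
Hypothesis X_random : C_random c X.

Definition rsqrt (N : nat) : R := N%:R `^ (- 2^-1).

Lemma rsqrt_ge0 N : 0 <= rsqrt N. Proof. exact: powR_ge0. Qed.

Lemma rsqrtX N n : rsqrt N ^+ n = N%:R `^ (- (n%:R / 2)).
Proof. by rewrite /rsqrt -powR_mulrn ?powR_ge0 // -powRrM mulNr mulrC. Qed.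

Lemma rsqrt_sqr N : (0 < N)%N -> rsqrt N ^+ 2 = N%:R^-1.
Proof. by move=> N0; rewrite rsqrtX divff // powR_inv1. Qed.

(** The moment condition restated for steps on one edge; the constants depend on the labels only,
    not on the edge or the directions of the steps. *)
Lemma edge_moment_bound (v : seq (I + J)) : exists M : R, exists N0 : nat,
  0 <= M /\ forall N, (N0 < N)%N -> forall (e : 'I_N * 'I_N) s, (e.1 <= e.2)%N ->
    labels s = v -> all (fun t => edge t == e) s ->
    normc (mean_steps (@X N) s) <= M * rsqrt N ^+ size v.
Proof.
have [M M0 [N0 H]] := C_random_moments X_random (tnth (in_tuple v)).
exists M, N0; split; first exact: ltW.
move=> N N0N [i j] s /= ij sv; subst v; rewrite rsqrtX => /all_nthP se.
pose cst := cast_ord (size_map (fun t : (I + J) * 'I_N * 'I_N => t.1.1) s).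
pose f l := tnth (in_tuple s) (cst l).
have /(_ _)/wrap[] := H N N0N i j ij (fun l => (f l).1.2) (fun l => (f l).2).
  move=> l; have := se (f l) _ (ltn_ord (cst l)).
  rewrite -(tnth_nth _ (in_tuple s)) -/(f l) => /eqP fe.
  have : (i, j) = edge (f l) by rewrite fe.
  by rewrite /edge; case: ifP => _ [-> ->]; rewrite !inE eqxx ?orbT.
congr (normc (expectL _) <= _).
rewrite /mean_steps [RHS]big_tnth (reindex cst) /=; last first.
  apply: onW_bij; exists (cast_ord (esym (size_map (fun t : (I + J) * 'I_N * 'I_N => t.1.1) s))).
    exact: cast_ordK.
  exact: cast_ordKV.
apply: eq_bigr => l _; rewrite -/(f l); congr (X _ _ _ _).
case: s @cst @f l {H se} => [|t0 s] cst f l; first by case: l.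
rewrite (tnth_nth t0.1.1) /f (tnth_nth t0); apply: (nth_map t0 t0.1.1 (fun t => t.1.1)).
exact: (ltn_ord (cst l)).
Qed.

Lemma mean_steps_bound (u : seq (I + J)) : exists M : R, exists N0 : nat,
  0 <= M /\ forall N, (N0 < N)%N -> forall s, labels s = u ->
    normc (mean_steps (@X N) s) <= M * rsqrt N ^+ size u.
Proof.
have [m] := ubnP (size u); elim: m u => // m IH [|a u] um.
  exists 1, 0%N; split => // N _ [|//] _.
  by rewrite mean_steps_nil Normc.normc1 mulr1.
pose n := (size u).+1.
have [M1 M1P] := choice (fun b : n.-tuple bool => edge_moment_bound (mask b (a :: u))).
have [N1 N1P] := choice M1P.
(* The bound is guarded by the length, as the induction hypothesis covers only strictly shorter
   words; for the mask that selects nothing the constants are dummies. *)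
have IH' (b : n.-tuple bool) : exists M : R, exists N0 : nat,
  0 <= M /\ ((size (mask (map negb b) (a :: u)) < n)%N -> forall N, (N0 < N)%N ->
    forall s, labels s = mask (map negb b) (a :: u) ->
    normc (mean_steps (@X N) s) <= M * rsqrt N ^+ size (mask (map negb b) (a :: u))).
  case: (ltnP (size (mask (map negb b) (a :: u))) n) => [lt|ge]; last by exists 0, 0%N.
  have [|M [N0 [M0 MP]]] := IH (mask (map negb b) (a :: u)).
    exact: leq_trans lt um.
  by exists M, N0.
have [M2 M2P] := choice IH'; have [N2 N2P] := choice M2P.
exists (\sum_b M1 b * M2 b), (\sum_b (N1 b + N2 b))%N.
have M12 b : 0 <= M1 b * M2 b by rewrite mulr_ge0 ?(N1P b).1 ?(N2P b).1.
split; first by apply: sumr_ge0 => b _.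
move=> N NN s su.
have : size s = n by rewrite -[LHS](size_map (fun t => t.1.1)) -/(labels s) su.
case: s su => [//|t s] su sn.
pose e := edge t; pose b0 := [seq edge t' == e | t' <- t :: s].
have b0n : size b0 == n by rewrite size_map sn.
pose b : n.-tuple bool := Tuple b0n.
have NNb : (N1 b + N2 b < N)%N by apply: leq_ltn_trans NN; rewrite (bigD1 b) //= leq_addr.
rewrite (mean_steps_split (C_random_selfadjoint X_random (N := N))
  (C_random_independent X_random (N := N)) _ (edge_le t)).
rewrite Normc.normcM.
have -> : [seq t' <- t :: s | edge t' == edge t] = mask b (t :: s) by rewrite filter_mask.
have -> : [seq t' <- t :: s | edge t' != edge t] = mask (map negb b) (t :: s).
  by rewrite filter_mask -map_comp.
have l1 : labels (mask b (t :: s)) = mask b (a :: u) by rewrite -su /labels map_mask.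
have l2 : labels (mask (map negb b) (t :: s)) = mask (map negb b) (a :: u).
  by rewrite -su /labels map_mask.
have sm : (size (mask b (a :: u)) + size (mask (map negb b) (a :: u)) = n)%N.
  rewrite !size_mask ?size_map ?size_tuple // count_map.
  by rewrite -[RHS](size_tuple b) -(count_predC id).
(* The first step lies on its own edge, so the remaining word is strictly shorter. *)
have s1 : (0 < size (mask b (a :: u)))%N by rewrite /= eqxx.
have B1 := (N1P b).2 N _ e (mask b (t :: s)) (edge_le t) l1.
have B2 := (N2P b).2 _ N _ _ l2.
apply: le_trans (_ : (M1 b * M2 b) * rsqrt N ^+ n <= _); last first.
  rewrite ler_wpM2r ?exprn_ge0 ?rsqrt_ge0 // (bigD1 b) //= lerDl.
  by apply: sumr_ge0.
have -> : rsqrt N ^+ n = rsqrt N ^+ size (mask b (a :: u)) *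
    rsqrt N ^+ size (mask (map negb b) (a :: u)) by rewrite -exprD sm.
rewrite mulrACA; apply: ler_pM; rewrite ?normc_ge0 //.
  apply: B1; first lia.
  by rewrite -filter_mask; exact: filter_all.
by apply: B2; lia.
Qed.

End Asymptotics.

(** * Convergence of the normalized traces *)

Section Limit.
Context (R : realType) (d : measure_display) (T : measurableType d).
Variable P : probability T R.
Local Notation C := R[i].
Variables (I J : Type) (c : I + J -> I + J -> C).
Variable X : forall N : nat, I + J -> 'M[Linfminus P]_N.
Hypothesis X_random : C_random c X.

(** In a walk of length [n] with at most [uphalf n] vertices, at most [(uphalf n).-1] of them are
    free, the root being fixed. The left side is the inverse of [N] for even [n] and [rsqrt R N] for
    odd [n]. *)
Lemma rsqrt_count N n : (0 < N)%N -> (0 < n)%N ->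
  (rsqrt R N) ^+ n * (N ^ (uphalf n).-1)%:R <= rsqrt R N.
Proof.
move=> N0 n0; have NN : N%:R != 0 :> R by rewrite pnatr_eq0 -lt0n.
have r1 : rsqrt R N <= 1.
  rewrite -(expr_le1 (n := 2)) ?rsqrt_ge0 // rsqrt_sqr // invf_le1 ?ltr0n //.
  by rewrite ler1n.
have r2 k : rsqrt R N ^+ (2 * k) * (N ^ k)%:R = 1.
  by rewrite exprM rsqrt_sqr // natrX -exprMn mulVf // expr1n.
have nE : (n = 2 * (uphalf n).-1 + (n - 2 * (uphalf n).-1))%N.
  by move: (odd_double_half n) n0; rewrite uphalf_half; lia.
rewrite {1}nE exprD mulrAC r2 mul1r.
have : (0 < n - 2 * (uphalf n).-1)%N.
  by move: (odd_double_half n) n0; rewrite uphalf_half; lia.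
case: (n - _)%N => // k _; rewrite exprS ler_piMr ?rsqrt_ge0 //.
by rewrite exprn_ile1 ?rsqrt_ge0.
Qed.

Lemma normc_normr (z : C) : `|z| = (normc z)%:C%C.
Proof. by case: z. Qed.

Lemma norm_reverse_sum_le N (s : seq ((I + J) * 'I_N * 'I_N)) : (0 < N)%N ->
  `|nc_pairing_sum (reverse_weight c N%:R^-1) s| <=
    (rsqrt R N)%:C%C ^+ size s * nc_pairing_sum (fun k l => `|c k l|) (labels s).
Proof.
move=> N0; rewrite nc_pairing_sum_map -nc_pairing_sum_scale.
apply: ler_norm_nc_pairing_sum => t t'; rewrite /reverse_weight.
have -> : (rsqrt R N)%:C%C ^+ 2 = N%:R^-1 :> C.
  by rewrite -rmorphXn rsqrt_sqr // fmorphV rmorph_nat.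
case: ifP => _; first by rewrite normrM ger0_norm ?invr_ge0 ?ler0n.
by rewrite normr0 mulr_ge0 ?invr_ge0 ?ler0n.
Qed.

(** By [walk_sum_nc] the pairing sum of [u] is itself a normalized sum over closed walks, so the
    difference can be taken walk by walk. For non-empty [u] it vanishes on walks with more than [m]
    vertices by [mean_steps_tree], and [count_walks] bounds the number of the others. *)
Lemma trace_bound (u : seq (I + J)) : exists B : R, exists N0 : nat, forall N, (N0 < N)%N ->
  `|N%:R^-1 * (\sum_x walk_sum u x x (mean_steps (@X N))) - nc_pairing_sum c u| <=
    (B * rsqrt R N)%:C%C :> C.
Proof.
have [M [N0 [M0 HM]]] := mean_steps_bound X_random u.
pose M' := complex.Re (nc_pairing_sum (fun k l => `|c k l|) u).
have M'E : nc_pairing_sum (fun k l => `|c k l|) u = M'%:C%C.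
  apply/esym/RRe_real; apply: ger0_real.
  apply: le_trans (normr_ge0 _) (@ler_norm_nc_pairing_sum _ _ c _ u _) => //.
(* A walk with [m.+1] vertices already has as many as [mean_steps_tree] requires. *)
pose m := uphalf (size u); pose B := (M + M') * (m.+1 ^ size u)%:R.
exists B, N0 => N NN; have N_gt0 : (0 < N)%N by apply: leq_ltn_trans NN.
have NC : N%:R != 0 :> C by rewrite pnatr_eq0 -lt0n.
pose W := reverse_weight (N := N) c N%:R^-1.
have WE : nc_pairing_sum c u = N%:R^-1 * \sum_(x < N) walk_sum u x x (nc_pairing_sum W).
  rewrite (eq_bigr (fun=> nc_pairing_sum c u)) => [|x _]; last first.
    by rewrite walk_sum_nc ?divff // eqxx mul1r.
  by rewrite sumr_const card_ord -[nc_pairing_sum c u *+ N]mulr_natl mulKf.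
rewrite {1}WE -mulrBr -sumrB.
under eq_bigr do rewrite -walk_sumB.
have M'0 : 0 <= M'.
  by rewrite -(@ler0c R) -M'E; apply: le_trans (normr_ge0 _) (@ler_norm_nc_pairing_sum _ _ c _ u _).
have nu0 : 0 <= rsqrt R N by exact: rsqrt_ge0.
(* For the empty word [m = 0], while the root alone is one vertex, so the count does not apply;
   there both terms are 1. *)
have [/size0nil u0|u0] := posnP (size u).
  rewrite big1 ?mulr0 ?normr0 ?ler0c ?mulr_ge0 ?addr_ge0 //.
  by rewrite u0 /= => x _; rewrite eqxx mean_steps_nil nc_pairing_sum_nil subrr.
rewrite normrM ger0_norm ?invr_ge0 ?ler0n //.
have step x : `|walk_sum u x x (fun s => mean_steps (@X N) s - nc_pairing_sum W s)| <=
    ((M + M') * rsqrt R N ^+ size u * (m.+1 ^ size u * N ^ m.-1)%:R)%:C%C.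
  have walk_bound : `|walk_sum u x x (fun s => mean_steps (@X N) s - nc_pairing_sum W s)| <=
      walk_sum u x x (fun s => ((M + M') * rsqrt R N ^+ size u)%:C%C *
        (#|finset.setU [set x]%SET (finset (fun y => y \in targets s))| <= m)%:R).
    apply: ler_norm_walk_sum => s su wk; have [le|gt] := leqP _ m.
      rewrite mulr1 mulrDl rmorphD; apply: le_trans (ler_normB _ _) _; apply: lerD.
        by rewrite normc_normr lecR; exact: HM.
      apply: le_trans (norm_reverse_sum_le s N_gt0) _.
      have -> : size s = size u by rewrite -su size_map.
      by rewrite su M'E -rmorphXn -rmorphM mulrC.
    rewrite mulr0 (@mean_steps_tree _ _ _ P _ _ c N (@X N) _ _ _ _ x s wk) ?subrr ?normr0 //.
    - by move=> *; exact: (C_random_centered X_random).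
    - by move=> *; exact: (C_random_selfadjoint X_random).
    - exact: (C_random_independent X_random).
    - by move=> *; exact: (C_random_covariance X_random).
    have -> : size s = size u by rewrite -su size_map.
    by move: gt; rewrite /m uphalf_half; move: (odd_double_half (size u)); lia.
  apply: le_trans walk_bound _; rewrite walk_sumZ [X in _ <= X]rmorphM.
  apply: ler_wpM2l; first by rewrite ler0c mulr_ge0 ?addr_ge0 ?exprn_ge0.
  rewrite rmorph_nat.
  have x1 : (#|[set x]%SET| <= m)%N by rewrite cards1 /m; case: (size u) u0 => [|[|k]].
  (* The count runs over all endpoints [z]; the closed walks are the term [z = x]. *)
  have := count_walks C u x x1; rewrite cards1 subn1; apply: le_trans.
  rewrite (bigD1 x) //= lerDl; apply: sumr_ge0 => z _.
  by apply: walk_sum_ge0 => s; exact: ler0n.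
have -> : (B * rsqrt R N)%:C%C = N%:R^-1 * \sum_(x < N) (B * rsqrt R N)%:C%C :> C.
  by rewrite sumr_const card_ord -[X in _ = _ * X]mulr_natl mulKf.
apply: ler_wpM2l; first by rewrite invr_ge0 ler0n.
apply: le_trans (ler_norm_sum _ _ _) _; apply: ler_sum => x _.
apply: le_trans (step x) _; rewrite lecR /B natrM -!mulrA ler_wpM2l ?addr_ge0 //.
rewrite mulrCA ler_wpM2l //.
by apply: rsqrt_count.
Qed.

Lemma trace_limit (u : seq (I + J)) :
  ((fun N : nat => N%:R^-1 * \sum_x walk_sum u x x (mean_steps (@X N))) : nat -> C^o)
    @ \oo --> (nc_pairing_sum c u : C^o).
Proof.
have [B [N0 H]] := trace_bound u.
apply/cvgrPdist_le => eps eps0.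
have [epsE eps_gt0] : eps = (complex.Re eps)%:C%C /\ 0 < complex.Re eps.
  move: eps0; rewrite ltcE /= => /andP[/eqP i0 r0]; split=> //.
  by case: eps i0 {r0} => a b /= ->.
(* [rsqrt R N <= D^-1] holds once [N] is at least [D ^+ 2]; the added 1 keeps [D] positive when
   [B = 0]. *)
pose D := (`|B| + 1) / complex.Re eps.
have D0 : 0 < D by rewrite divr_gt0 // ltr_wpDl.
near=> N.
have NN : (N0 < N)%N by near: N; exact: nbhs_infty_gt.
have ND : D ^+ 2 <= N%:R by near: N; exact: nbhs_infty_ger.
have N_gt0 : (0 < N)%N by apply: leq_ltn_trans NN.
rewrite distrC; apply: le_trans (H N NN) _; rewrite epsE lecR.
have rD : rsqrt R N <= D^-1.
  rewrite -(ler_pXn2r (n := 2)) ?nnegrE ?rsqrt_ge0 ?invr_ge0 ?(ltW D0) //.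
  by rewrite rsqrt_sqr // exprVn lef_pV2 // posrE ?ltr0n ?exprn_gt0.
apply: le_trans (_ : (`|B| + 1) * D^-1 <= _); last first.
  by rewrite /D invf_div mulrCA divff ?mulr1 // gt_eqF // ltr_wpDl.
apply: le_trans (_ : (`|B| + 1) * rsqrt R N <= _).
  by rewrite ler_wpM2r ?rsqrt_ge0 // ler_wpDr // ler_norm.
by rewrite ler_wpM2l // addr_ge0.
Unshelve. all: by end_near. Qed.

End Limit.

Theorem theorem2p2 (R : realType) (I J : Type) (c : I + J -> I + J -> R[i])
  (c_pd : positive_definite c)
  (c_real : forall k m : I + J, c k m \is Num.real)
  (A : algType R[i]) (star : A -> A) (phi : {scalar A})
  (A_star : star_probability_space star phi)
  (phi_tracial : tracial phi)
  (a : I + J -> A)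
  (a_selfadjoint : forall k : I + J, star (a k) = a k)
  (a_clt : bifree_clt phi a c)
  (d : measure_display) (Omega : measurableType d) (P : probability Omega R)
  (X : forall N : nat, I + J -> 'M[Linfminus P]_N)
  (X_random : C_random c X)
  (n : nat) (chi : 'I_n -> I + J) :
  ((fun N : nat =>
      N%:R^-1 * \tr (expectLXN
        (\big[@LXN_mul _ _ _ P N/LXN_one P N]_(k < n)
           two_faced (@X N) (chi k)))) : nat -> R[i]^o) @ \oo
    --> (phi (\prod_(k < n) a (chi k)) : R[i]^o).
Proof.
(* A Hermitian matrix with real entries is symmetric. *)
have c_sym k l : c k l = c l k.
  by rewrite (c_pd.1 l k); apply/CrealP; exact: c_real.
have -> : \prod_(k < n) a (chi k) = \prod_(k <- [seq chi k | k <- enum 'I_n]) a k.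
  by rewrite big_map; congr bigop; rewrite enumT [index_enum _]unlock.
rewrite (bifree_clt_moment c_sym (state1 A_star) a_clt).
under eq_fun do rewrite trace_two_faced.
exact: trace_limit.
Qed.
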